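(* Let $\Sigma\subset\mathbb{C}P^3$ be an $I_1'$-holomorphic curve. Then its Hopf lift $p_1^{-1}(\Sigma)\subset S^7$ is associative in the squashed $S^7$.
   Context: The squashed $S^7$. Let $J=\begin{pmatrix}J'&0\\0&J'\end{pmatrix}$, $J'=\begin{pmatrix}0&-1\\1&0\end{pmatrix}$, and let the unit quaternions ${\rm Sp}(1)$ act on $\mathbb{C}^4\cong\mathbb{H}^2$, $(z_1,\dots,z_4)\mapsto(z_1+z_2j,z_3+z_4j)$, by $(a_1+a_2j)\cdot u=a_1u+a_2J\overline u$. Let $I_1,I_2,I_3$ be the complex structures on $\mathbb{C}^4$ given by $i,j,k$, $g$ the round metric on $S^7$, $(\xi_i)_z=-I_i(z)$, $\eta_i=g(\xi_i,\cdot)$. Let $\mathcal{V}={\rm span}\{\xi_1,\xi_2,\xi_3\}\subset TS^7$, $\mathcal{H}$ its $g$-orthogonal complement, $\top:TS^7\to\mathcal{H}$ the projection, $\omega_i=\frac12d\eta_i((\cdot)^\top,(\cdot)^\top)$. Define $\tilde g$ by $\tilde g|_{\mathcal{V}\times\mathcal{V}}=(3/5)^2g|_{\mathcal{V}\times\mathcal{V}}$, $\tilde g|_{\mathcal{H}\times\mathcal{H}}=(3/\sqrt5)^2g|_{\mathcal{H}\times\mathcal{H}}$, $\tilde g|_{\mathcal{H}\times\mathcal{V}}=0$, and $\tilde\varphi=\frac{27}{25}(\frac15\eta_1\wedge\eta_2\wedge\eta_3+\sum_{i=1}^3\eta_i\wedge\omega_i)$, a nearly parallel $G_2$-structure on $S^7$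 with induced metric $\tilde g$. $(S^7,\tilde\varphi,\tilde g)$ is the squashed $S^7$. A $3$-dimensional submanifold $A\subset S^7$ is associative if, for a suitable orientation, $\tilde\varphi|_{TA}$ is the volume form of $\tilde g|_A$. The almost complex structure $I_1'$. Let $p_1:S^7\to\mathbb{C}P^3$ be the Hopf fibration for the complex structure $I_1$, and $p_2:\mathbb{C}P^3\to S^4$ the twistor fibration, so that $p_2\circ p_1$ is the quaternionic Hopf fibration $S^7\to S^4=\mathbb{H}P^1$. Let $\underline{\mathcal V}\subset T\mathbb{C}P^3$ be the bundle tangent to the fibers of $p_2$ and $\underline{\mathcal H}$ its orthogonal complement (these are the distributions induced by $\mathcal V$ and $\mathcal H$). With $I_1$ also denoting the standard complex structure of $\mathbb{C}P^3$, define the almost complex structure $I_1'$ on $\mathbb{C}P^3$ by $I_1'|_{\underline{\mathcal V}}=-I_1|_{\underline{\mathcal V}}$, $I_1'|_{\underline{\mathcal H}}=I_1|_{\underline{\mathcal H}}$. An $I_1'$-holomorphic curve is a real $2$-dimensional submanifold whose tangent spaces are $I_1'$-invariant. *)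

(* Defs.v *)
From HB Require Import structures.
From mathcomp Require Import all_boot all_order all_algebra.
From mathcomp Require Import all_classical all_reals all_analysis.

Set Implicit Arguments.
Unset Strict Implicit.
Unset Printing Implicit Defensive.

Import Order.TTheory GRing.Theory Num.Theory.
Import numFieldNormedType.Exports.

Local Open Scope classical_set_scope.
Local Open Scope ring_scope.

Section EmbeddedSubmanifolds.
Context {R : realType}.

(* C^n on an open set U; this agrees with the usual notion because it is only
   used for maps between finite-dimensional spaces, where it suffices to iterate
   directional derivatives along constant vectors. *)
Fixpoint Cn_on {V W : normedModType R} (n : nat) (U : set V) (f : V -> W) : Prop :=
  match n with
  | 0 => forall x, U x -> {for x, continuous f}
  | m.+1 => (forall x, U x -> differentiable f x) /\
            (forall v : V, Cn_on m U (fun x => 'D_v f x))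
  end.

Definition smooth_on {V W : normedModType R} (U : set V) (f : V -> W) : Prop :=
  forall n, Cn_on n U f.

Context {V : normedModType R}.

(* The last clause says that psi is open onto M for the subspace topology; with
   injectivity, psi is a homeomorphism of U onto a relatively open part of M. *)
Definition local_parametrization (k : nat) (M : set V)
    (U : set 'rV[R]_k) (psi : 'rV[R]_k -> V) : Prop :=
  [/\ open U, smooth_on U psi,
      (forall x y, U x -> U y -> psi x = psi y -> x = y),
      (forall x, U x -> injective ('d psi x)) &
      (forall U' : set 'rV[R]_k, open U' -> U' `<=` U ->
         exists2 O : set V, open O & psi @` U' = M `&` O)].

(* M is an embedded smooth submanifold of V of dimension k. *)
Definition submanifold (k : nat) (M : set V) : Prop :=
  forall p, M p -> exists U psi,
    @local_parametrization k M U psi /\ (psi @` U) p.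

(* Velocities at p of smooth curves contained in M. *)
Definition tangent_space (M : set V) (p : V) : set V :=
  [set v | exists (gamma : R -> V) (e : R),
     [/\ 0 < e, smooth_on (ball (0 : R) e) gamma,
         (forall t, ball (0 : R) e t -> M (gamma t)),
         gamma 0 = p & 'D_1 gamma 0 = v]].

Definition is_basis (k : nat) (T : set V) (e : 'I_k -> V) : Prop :=
  [/\ (forall i, T (e i)),
      (forall c : 'I_k -> R, \sum_i c i *: e i = 0 -> forall i, c i = 0) &
      (forall v, T v -> exists c : 'I_k -> R, v = \sum_i c i *: e i)].

Definition coordinate_frame (k : nat) (psi : 'rV[R]_k -> V)
    (x : 'rV[R]_k) (i : 'I_k) : V := 'd psi x (delta_mx 0 i).

(* [o p e] reads "e is a positively oriented basis of the tangent space of M at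
   p". The first clause says that o selects one of the two orientations of each
   tangent space, the second that the selection is locally constant in charts. *)
Definition is_orientation (k : nat) (M : set V)
    (o : V -> ('I_k -> V) -> Prop) : Prop :=
  (forall p, M p -> forall e e' : 'I_k -> V,
     is_basis (tangent_space M p) e -> is_basis (tangent_space M p) e' ->
     o p e ->
     (o p e' <-> exists A : 'M[R]_k,
        0 < \det A /\ forall i, e' i = \sum_j A i j *: e j)) /\
  (forall p, M p -> exists U psi,
     [/\ @local_parametrization k M U psi, (psi @` U) p &
         forall x, U x -> o (psi x) (coordinate_frame psi x)]).

(* The volume form of a metric h on M oriented by o is the form with value 1 on
   positively oriented h-orthonormal bases of the tangent spaces. *)
Definition restricts_to_volume_form (k : nat) (M : set V)
    (o : V -> ('I_k -> V) -> Prop) (h : V -> V -> V -> R)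
    (phi : V -> ('I_k -> V) -> R) : Prop :=
  forall p, M p -> forall e : 'I_k -> V,
    is_basis (tangent_space M p) e ->
    (forall i j, h p (e i) (e j) = (i == j)%:R) ->
    o p e -> phi p e = 1.

Definition ext_deriv1 (alpha : V -> V -> R) (p u v : V) : R :=
  'D_u (fun y => alpha y v) p - 'D_v (fun y => alpha y u) p.

Definition wedge12 (alpha : V -> R) (beta : V -> V -> R) (e : 'I_3 -> V) : R :=
  let e0 := e 0 in let e1 := e 1 in let e2 := e 2%:R in
  alpha e0 * beta e1 e2 - alpha e1 * beta e0 e2 + alpha e2 * beta e0 e1.

End EmbeddedSubmanifolds.

Section SquashedSphere.
Context (R : realType).

(* A pair (a, b) of real numbers, column vectors or matrices stands for a + ib. *)
Definition C4 := ('cV[R]_4 * 'cV[R]_4)%type.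
Definition CM4 := ('M[R]_4 * 'M[R]_4)%type.

Definition cscale (a : R * R) (u : C4) : C4 :=
  (a.1 *: u.1 - a.2 *: u.2, a.1 *: u.2 + a.2 *: u.1).

Definition cmulmx (A B : CM4) : CM4 :=
  (A.1 *m B.1 - A.2 *m B.2, A.1 *m B.2 + A.2 *m B.1).

Definition J' : 'M[R]_2 := \matrix_(i < 2, j < 2) ((j < i)%N%:R - (i < j)%N%:R).
Definition J : 'M[R]_4 := block_mx J' 0 0 J'.

(* (a1 + a2 j) . u = a1 u + a2 J (conj u) *)
Definition quat_act (a1 a2 : R * R) (u : C4) : C4 :=
  cscale a1 u + cscale a2 (J *m u.1, - (J *m u.2)).

(* The quaternions i, j, k = i j, each written as the pair (a1, a2). *)
Definition quat_unit (i : 'I_3) : (R * R) * (R * R) :=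
  match val i with
  | 0 => ((0, 1), (0, 0))
  | 1 => ((0, 0), (1, 0))
  | _ => ((0, 0), (0, 1))
  end.

Definition I_ (i : 'I_3) (u : C4) : C4 :=
  quat_act (quat_unit i).1 (quat_unit i).2 u.

Definition g (u v : C4) : R :=
  \sum_(l < 4) (u.1 l 0 * v.1 l 0 + u.2 l 0 * v.2 l 0).

Definition S7 : set C4 := [set z | g z z = 1].

Definition xi (i : 'I_3) (z : C4) : C4 := - I_ i z.

Definition eta (i : 'I_3) (z v : C4) : R := g (xi i z) v.

(* At z in S7 the xi i z are g-orthonormal, so these are the orthogonal
   projections of T_z S7 onto the vertical and horizontal spaces. *)
Definition vproj (z v : C4) : C4 := \sum_i eta i z v *: xi i z.
Definition hproj (z v : C4) : C4 := v - vproj z v.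

(* eta i is defined on all of C^4 and exterior differentiation commutes with
   restriction to S7, so its derivative may be taken in C^4. *)
Definition omega (i : 'I_3) (z u v : C4) : R :=
  2^-1 * ext_deriv1 (eta i) z (hproj z u) (hproj z v).

Definition squashed_metric (z u v : C4) : R :=
  (3 / 5) ^+ 2 * g (vproj z u) (vproj z v) +
  (3 / Num.sqrt 5) ^+ 2 * g (hproj z u) (hproj z v).

(* The determinant is the value of eta_1 /\ eta_2 /\ eta_3 on e. *)
Definition squashed_form (z : C4) (e : 'I_3 -> C4) : R :=
  27 / 25 * (1 / 5 * \det (\matrix_(i < 3, j < 3) eta i z (e j)) +
             \sum_i wedge12 (eta i z) (omega i z) e).

Definition associative_submanifold (A : set C4) : Prop :=
  [/\ A `<=` S7, submanifold 3 A &
      exists o, is_orientation A o /\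
        restricts_to_volume_form A o squashed_metric squashed_form].

(* The Hopf fibration z |-> z z^* : complex projective 3-space is embedded in the
   Hermitian matrices as the set of orthogonal projectors onto complex lines. *)
Definition p1 (z : C4) : CM4 :=
  (z.1 *m z.1^T + z.2 *m z.2^T, z.2 *m z.1^T - z.1 *m z.2^T).

Definition CP3 : set CM4 := p1 @` S7.

(* P |-> P + J (conj P) J^T. For P = z z^* this is the orthogonal projector onto
   the complex span of z and J (conj z), i.e. onto the quaternionic line of z;
   HP^1 = S^4 is thereby embedded in the Hermitian matrices, and p2 o p1 is the
   quaternionic Hopf fibration. *)
Definition p2 (P : CM4) : CM4 :=
  (P.1 + J *m P.1 *m J^T, P.2 - J *m P.2 *m J^T).

(* The metric Re tr (X Y^* ) / 2, for which p1 is a Riemannian submersion from the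
   round sphere, i.e. the Fubini-Study metric. *)
Definition fubini_study (X Y : CM4) : R :=
  2^-1 * \sum_(k < 4) \sum_(l < 4) (X.1 k l * Y.1 k l + X.2 k l * Y.2 k l).

(* X |-> i (X P - P X). At P = z z^*, a tangent vector is X = w z^* + z w^* with
   w Hermitian-orthogonal to z, and its image is (i w) z^* + z (i w)^*. *)
Definition I1_CP3 (P X : CM4) : CM4 :=
  let Y := cmulmx X P - cmulmx P X in (- Y.2, Y.1).

Definition V_CP3 (P : CM4) : set CM4 :=
  tangent_space [set Q | CP3 Q /\ p2 Q = p2 P] P.

Definition H_CP3 (P : CM4) : set CM4 :=
  [set X | tangent_space CP3 P X /\ forall Y, V_CP3 P Y -> fubini_study X Y = 0].

Definition I1'_CP3 (P X : CM4) : CM4 :=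
  xget 0 [set Y | exists Xv Xh, [/\ V_CP3 P Xv, H_CP3 P Xh, X = Xv + Xh &
                                   Y = - I1_CP3 P Xv + I1_CP3 P Xh]].

Definition I1'_holomorphic_curve (Sigma : set CM4) : Prop :=
  [/\ Sigma `<=` CP3, submanifold 2 Sigma &
      forall P X, Sigma P -> tangent_space Sigma P X ->
        tangent_space Sigma P (I1'_CP3 P X)].

Definition Hopf_lift (Sigma : set CM4) : set C4 := S7 `&` p1 @^-1` Sigma.

End SquashedSphere.

(* Main.v *)
Require Import Defs.
From HB Require Import structures.
From mathcomp Require Import all_boot all_order all_algebra.
From mathcomp Require Import all_classical all_reals all_analysis.
From mathcomp Require Import ring lra.

(** Let z be in the Hopf lift A of Sigma. The differential of p1 at z is
    D w = z w^* + w z^*; it kills I1 z and identifies the orthogonal complement of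
    z and I1 z with the tangent space of CP3 at p1 z, so that the vertical space of
    the twistor fibration corresponds to span (I2 z, I3 z) and the horizontal one to
    the quaternionic orthogonal complement of z. If D w is tangent to Sigma, with
    w = a I2 z + b I3 z + h, then so is I1' (D w) = D w', where
    w' = b I2 z - a I3 z + I1 h. Since Sigma is 2-dimensional, T_z A is spanned by
    I1 z, w and w', which are orthogonal for the squashed metric, and a computation
    gives the value 1 to the squashed form on the normalised frame. Orienting A by
    the sign of the squashed form makes A associative.

    Charts of A are obtained from a chart psi of Sigma as the unit vectors in the
    direction of (1 + i s t) psi(x) z0. *)

Set Implicit Arguments.
Unset Strict Implicit.
Unset Printing Implicit Defensive.

Import Order.TTheory GRing.Theory Num.Theory.
Import numFieldNormedType.Exports.

Local Open Scope classical_set_scope.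
Local Open Scope ring_scope.

(** * Smooth calculus in finite dimension *)

(** Tangent vectors are velocities of curves and [CP3] is a set of projectors, so the tangent,
    vertical and horizontal spaces of [CP3] are computed without charts: curves of projectors are
    lifted to [S7], and explicit curves of [S7] are projected back. Afterwards everything is linear
    algebra in C^4, where the Hermitian product is u^* v = [g u v] + i [g (I1 u) v]. The sign change
    of I1' on vertical vectors makes the form and the metric match. On I1 z, w, w' the term eta_1 /\
    eta_2 /\ eta_3 contributes a positive multiple of a^2 + b^2 and eta_1 /\ omega_1 a positive
    multiple of |h|^2, up to a common sign; with I1 in place of I1' the two would have opposite
    signs. The squashing factors then turn their sum into the squared norm of w. The remaining
    obstacle is the orientation, which asks for charts in which the form is positive on the whole
    domain. The form is nonzero on a coordinate frame, its sign at one point spreads to a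
    neighbourhood by continuity, and a wrong sign is corrected by reversing the fibre coordinate. *)

Section FiniteDimension.
Context {R : realType}.

Definition pack_lin (V W : lmodType R) (f : V -> W) (lf : linear f) : {linear V -> W} :=
  HB.pack f (GRing.isLinear.Build R V W *:%R f lf).

(** A form of finite dimension that passes to products, as [C4] and [CM4] are pairs of matrix
    spaces. It makes linear and bilinear maps out of such spaces continuous. *)
Definition has_coordinates (V : normedModType R) := exists n (c : 'I_n -> V -> R) (e : 'I_n -> V),
  [/\ (forall i, continuous (c i)), (forall i, linear (c i : V -> R^o)) &
      forall u, u = \sum_i c i u *: e i].

Lemma has_coordinates_mx m n : has_coordinates 'M[R]_(m, n).
Proof.
exists #|{: 'I_m * 'I_n}|.
exists (fun k (M : 'M[R]_(m, n)) => M (enum_val k).1 (enum_val k).2).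
exists (fun k => delta_mx (enum_val k).1 (enum_val k).2); split.
- by move=> k; exact: coord_continuous.
- by move=> k a u v; rewrite !mxE.
- move=> u; rewrite {1}[u]matrix_sum_delta pair_big /=.
  rewrite (reindex (@enum_val ('I_m * 'I_n)%type predT)) //=.
  by apply: onW_bij; exact: enum_val_bij.
Qed.

Lemma has_coordinates_prod (V W : normedModType R) :
  has_coordinates V -> has_coordinates W -> has_coordinates (V * W)%type.
Proof.
move=> [n [c [e [cc lc sc]]]] [m [d [f [cd ld sd]]]].
exists (n + m)%N.
exists (fun k p => match fintype.split k with inl i => c i p.1 | inr j => d j p.2 end).
exists (fun k => match fintype.split k with inl i => (e i, 0) | inr j => (0, f j) end).
split.
- move=> k; case: (fintype.split k) => j p.
    by apply: continuous_comp; [exact: cvg_fst | exact: cc].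
  by apply: continuous_comp; [exact: cvg_snd | exact: cd].
- by move=> k; case: (fintype.split k) => j a u v /=; [exact: lc | exact: ld].
- move=> [u v]; rewrite big_split_ord /=.
  under eq_bigr do rewrite (unsplitK (inl _)) /=.
  under [X in _ + X]eq_bigr do rewrite (unsplitK (inr _)) /=.
  rewrite {1}(sc u) {1}(sd v).
  have H1 (F : 'I_n -> R) : \sum_i F i *: (e i, 0 : W) = (\sum_i F i *: e i, 0).
    by elim/big_rec2: _ => // i y1 y2 _ ->; rewrite -[LHS]/((_, _)) /= scaler0 add0r.
  have H2 (F : 'I_m -> R) : \sum_i F i *: (0 : V, f i) = (0, \sum_i F i *: f i).
    by elim/big_rec2: _ => // i y1 y2 _ ->; rewrite -[LHS]/((_, _)) /= scaler0 add0r.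
  by rewrite H1 H2 -[RHS]/((_, _)) /= addr0 add0r.
Qed.

Lemma continuous_sum_ord (T : topologicalType) (W : normedModType R) n (F : 'I_n -> T -> W) x :
  (forall i, {for x, continuous (F i)}) -> {for x, continuous (fun y => \sum_i F i y)}.
Proof.
move=> H; elim: n F H => [|n IH] F H.
  have -> : (fun y => \sum_(i < 0) F i y) = cst 0 by apply/funext => y; rewrite big_ord0.
  exact: cvg_cst.
have -> : (fun y => \sum_(i < n.+1) F i y) =
    (fun y => \sum_(i < n) F (widen_ord (leqnSn n) i) y) \+ F ord_max.
  by apply/funext => y; rewrite big_ord_recr.
by apply: cvgD; [exact: IH | exact: H].
Qed.

Lemma linear_sumE (V W : lmodType R) (L : V -> W) n (c : 'I_n -> R) (e : 'I_n -> V) :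
  linear L -> L (\sum_i c i *: e i) = \sum_i c i *: L (e i).
Proof.
move=> lL; rewrite -[L]/(pack_lin lL : V -> W) linear_sum.
by apply: eq_bigr => i _; rewrite linearZ.
Qed.

Lemma linear_finite_continuous (V W : normedModType R) (L : V -> W) :
  has_coordinates V -> linear L -> continuous L.
Proof.
move=> [n [c [e [cc _ s]]]] lL x.
have -> : L = fun u => \sum_i c i u *: L (e i).
  by apply/funext => u; rewrite {1}(s u) linear_sumE.
by apply: continuous_sum_ord => i; apply: cvgZr_tmp; exact: cc.
Qed.

Lemma bilinear_finite_continuous (U V W : normedModType R) (B : U -> V -> W) :
  has_coordinates U -> has_coordinates V ->
  (forall v, linear (B^~ v)) -> (forall u, linear (B u)) ->
  continuous (fun p => B p.1 p.2).
Proof.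
move=> [n [c [e [cc _ s]]]] fV l1 l2 x.
have -> : (fun p : U * V => B p.1 p.2) = fun p => \sum_i c i p.1 *: B (e i) p.2.
  apply/funext => -[u v] /=; rewrite {1}(s u).
  by rewrite -[LHS]/((fun u => B u v) _) linear_sumE.
apply: continuous_sum_ord => i; apply: cvgZ.
  by apply: continuous_comp; [exact: cvg_fst | exact: cc].
apply: continuous_comp; first exact: cvg_snd.
exact: linear_finite_continuous.
Qed.

End FiniteDimension.

(** * Locality of differentials and the Leibniz rule for bilinear maps *)

Section Differentials.
Context {R : realType}.

(** Serves to differentiate identities that hold only on an open set. The first-order expansion of
    [f] is also one of [g], and [diff_unique] reads the differential of [g] off it before
    differentiability of [g] is known. *)
Lemma is_diff_near_eq (V W : normedModType R) (f g df : V -> W) (x : V) :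
  {near x, f =1 g} -> is_diff x f df -> is_diff x g df.
Proof.
move=> fg [dfx <-].
have cd : continuous ('d f x) by exact: diff_continuous.
have E : g \o shift x = cst (g x) + 'd f x +o_ 0 id.
  apply/eqaddoP => eps e0.
  have /diff_locally/eqaddoP/(_ eps e0) H := dfx.
  have fgx : f x = g x by exact: nbhs_singleton fg.
  near=> h.
  have -> : (g \o shift x - (cst (g x) + 'd f x)) h = (f \o shift x - (cst (f x) + 'd f x)) h.
    rewrite /= /cst -[LHS]/(g (h + x) - (g x + 'd f x h)) -[RHS]/(f (h + x) - (f x + 'd f x h)).
    rewrite fgx; congr (_ - _); apply/esym; near: h.
    have : \forall y \near x, f y = g y by exact: fg.
    by rewrite (near_shift 0) /= subr0.
  by near: h.
have E2 := diff_unique cd E.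
apply: DiffDef => //; apply/diff_locallyP; split; first by rewrite E2.
by rewrite E2.
Unshelve. all: by end_near. Qed.

Lemma is_diff_linear (V W : normedModType R) (L : V -> W) (x : V) :
  linear L -> continuous L -> is_diff x L L.
Proof.
move=> lL cL; rewrite -[L]/(pack_lin lL : V -> W); apply: DiffDef.
  exact: linear_differentiable.
by rewrite diff_lin.
Qed.

Lemma is_diff_affine (V W : normedModType R) (L : V -> W) (b : W) (x : V) :
  linear L -> continuous L -> is_diff x (fun x => L x + b) L.
Proof.
move=> lL cL.
have := @is_diffD _ _ _ L (cst b) L (cst 0) x (is_diff_linear x lL cL) (is_diff_cst b x).
by rewrite (_ : L + cst 0 = L) //; apply/funext => y; exact: addr0.
Qed.

Lemma is_diff_bilinear (T U V W : normedModType R) (B : U -> V -> W)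
    (f df : T -> U) (g dg : T -> V) (x : T) :
  (forall v, linear (B^~ v)) -> (forall u, linear (B u)) ->
  continuous (fun p => B p.1 p.2) ->
  is_diff x f df -> is_diff x g dg ->
  is_diff x (fun y => B (f y) (g y)) (fun h => B (df h) (g x) + B (f x) (dg h)).
Proof.
move=> l1 l2 cB [dfx Ef] [dgx Eg].
have bB : bilinear_for (GRing.Scale.Law.clone _ _ *:%R _) (GRing.Scale.Law.clone _ _ *:%R _) B
  by split=> ? ? ? ?; [exact: l1 | exact: l2].
pose BB : {bilinear U -> V -> W} := HB.pack B (bilinear_isBilinear.Build R U V W _ _ B bB).
have dB p : is_diff p (fun q => BB q.1 q.2) (fun q => BB p.1 q.2 + BB q.1 p.2).
  by apply: DiffDef; [exact: differentiable_bilin | exact: diff_bilin].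
have dp : is_diff x (fun y => (f y, g y)) (fun h => ('d f x h, 'd g x h)).
  by apply: is_diff_pair; exact: differentiableP.
have := @is_diff_comp R T (U * V)%type W _ _ _ _ x dp (dB (f x, g x)).
move=> [h1 h2]; apply: DiffDef; first exact: h1.
by rewrite -Ef -Eg; move: h2 => /= ->; apply/funext => h /=; rewrite addrC.
Qed.

End Differentials.

(** * Stability of [Cn_on] under algebraic operations *)

Section SmoothCalculus.
Context {R : realType}.

Lemma is_diff_derive (V W : normedModType R) (f df : V -> W) (x v : V) :
  is_diff x f df -> 'D_v f x = df v.
Proof. by move=> [dfx <-]; rewrite deriveE. Qed.

Lemma Cn_on_sub (V W : normedModType R) n (U U' : set V) (f : V -> W) :
  U' `<=` U -> Cn_on n U f -> Cn_on n U' f.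
Proof.
move=> sU; elim: n f => [|n IH] f /=; first by move=> H x /sU/H.
by move=> [d H]; split=> [x /sU/d //|v]; apply: IH.
Qed.

Lemma open_near_eq (V : normedModType R) (W : Type) (U : set V) (f g : V -> W) x :
  open U -> U x -> (forall y, U y -> f y = g y) -> {near x, f =1 g}.
Proof.
move=> oU Ux E; have : nbhs x U by exact: open_nbhs_nbhs.
by apply: filterS => y /E.
Qed.

Lemma Cn_on_ext (V W : normedModType R) n (U : set V) (f g : V -> W) :
  open U -> (forall x, U x -> f x = g x) -> Cn_on n U f -> Cn_on n U g.
Proof.
move=> oU; elim: n f g => [|n IH] f g E /=.
  move=> H x Ux; rewrite /prop_for /continuous_at -E //.
  apply: cvg_trans (H x Ux); apply: near_eq_cvg.
  by have := open_near_eq oU Ux E.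
move=> [d H]; split=> [x Ux|v].
  by case: (is_diff_near_eq (open_near_eq oU Ux E) (differentiableP (d x Ux))).
apply: IH (H v) => x Ux; apply: near_eq_derive.
exact: open_near_eq oU Ux E.
Qed.

(** In a Leibniz induction one factor stays undifferentiated and has to be lowered from order n + 1
    to order n. *)
Lemma Cn_onW (V W : normedModType R) n (U : set V) (f : V -> W) :
  Cn_on n.+1 U f -> Cn_on n U f.
Proof.
elim: n f => [|n IH] f [d H].
  by move=> x /d/differentiable_continuous.
by split=> // v; apply: IH; exact: H.
Qed.

Lemma Cn_on_cst (V W : normedModType R) n (U : set V) (a : W) : Cn_on n U (fun _ : V => a).
Proof.
elim: n a => [|n IH] a /=; first by move=> x _; exact: cvg_cst.
split=> [x _|v]; first exact: differentiable_cst.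
have -> : (fun x : V => 'D_v (fun=> a) x) = fun=> 0 by apply/funext => x; exact: derive_cst.
exact: IH.
Qed.

Lemma Cn_on_add (V W : normedModType R) n (U : set V) (f g : V -> W) :
  open U -> Cn_on n U f -> Cn_on n U g -> Cn_on n U (fun x => f x + g x).
Proof.
move=> oU; elim: n f g => [|n IH] f g /=.
  by move=> H H' x Ux; apply: cvgD; [exact: H | exact: H'].
move=> [d H] [d' H']; split=> [x Ux|v].
  by apply: differentiableD; [exact: d | exact: d'].
apply: Cn_on_ext (IH _ _ (H v) (H' v)) => // x Ux.
by rewrite [RHS]deriveD //; apply: diff_derivable; [exact: d | exact: d'].
Qed.

Lemma Cn_on_linear (V W Z : normedModType R) n (U : set V) (L : W -> Z) (f : V -> W) :
  linear L -> continuous L -> open U -> Cn_on n U f -> Cn_on n U (fun x => L (f x)).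
Proof.
move=> lL cL oU; elim: n f => [|n IH] f /=.
  by move=> H x Ux; apply: (@continuous_comp _ _ _ f L); [exact: H | exact: cL].
move=> [d H].
have dL x : U x -> is_diff x (L \o f) (L \o 'd f x).
  by move=> Ux; apply: is_diff_comp; [exact: differentiableP (d x Ux) | exact: is_diff_linear].
split=> [x /dL[] //|v]; apply: Cn_on_ext (IH _ (H v)) => // x Ux.
by rewrite (is_diff_derive v (dL x Ux)) /= deriveE //; exact: d.
Qed.

(** Scalar multiplication, [g] and [outer] are bilinear, so a single induction covers all of them:
    the derivative in direction v is a sum of two terms of the same shape, of order one less. *)
Lemma Cn_on_bilinear (T V W Z : normedModType R) n (U : set T) (B : V -> W -> Z)
    (f : T -> V) (g : T -> W) :
  (forall v, linear (B^~ v)) -> (forall u, linear (B u)) -> continuous (fun p => B p.1 p.2) ->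
  open U -> Cn_on n U f -> Cn_on n U g -> Cn_on n U (fun x => B (f x) (g x)).
Proof.
move=> l1 l2 cB oU; elim: n f g => [|n IH] f g.
  move=> /= H H' x Ux.
  apply: (@continuous_comp _ _ _ (fun x => (f x, g x)) (fun p => B p.1 p.2)); last exact: cB.
  by apply: cvg_pair; [exact: H | exact: H'].
move=> Hf Hg; have /= [d H] := Hf; have /= [d' H'] := Hg.
have dB x : U x -> is_diff x (fun y => B (f y) (g y)) (fun h => B ('d f x h) (g x) +
  B (f x) ('d g x h)).
  by move=> Ux; apply: is_diff_bilinear => //; apply: differentiableP; [exact: d | exact: d'].
split=> [x /dB[] //|v].
have := Cn_on_add oU (IH _ _ (H v) (Cn_onW Hg)) (IH _ _ (Cn_onW Hf) (H' v)).
apply: Cn_on_ext => // x Ux.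
rewrite (is_diff_derive v (dB x Ux)) !deriveE //; [exact: d' | exact: d].
Qed.

Lemma Cn_on_scale (T W : normedModType R) n (U : set T) (f : T -> R) (g : T -> W) :
  open U -> Cn_on n U f -> Cn_on n U g -> Cn_on n U (fun x => f x *: g x).
Proof.
move=> oU Hf Hg; apply: (@Cn_on_bilinear _ R^o _ _ n U (fun a w => a *: w) f g) => //.
- by move=> v a b c /=; rewrite scalerDl scalerA.
- by move=> u a b c /=; rewrite scalerDr !scalerA mulrC.
- exact: scale_continuous.
Qed.

Lemma Cn_on_affine (V W : normedModType R) n (U : set V) (L : V -> W) (b : W) :
  linear L -> continuous L -> Cn_on n U (fun x => L x + b).
Proof.
move=> lL cL; have dA x := is_diff_affine b x lL cL.
case: n => [|n] /=.
  by move=> x _; apply: differentiable_continuous; case: (dA x).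
split=> [x _|v]; first by case: (dA x).
have -> : (fun x => 'D_v (fun x => L x + b) x) = fun=> L v.
  by apply/funext => x; rewrite (is_diff_derive v (dA x)).
exact: Cn_on_cst.
Qed.

(** Chart maps get precomposed with affine maps, namely lines in a chart and [base_coord]. The
    derivative along v of such a composite is the derivative along [L v] composed with the same
    affine map, so the induction closes. *)
Lemma Cn_on_comp_affine (V W Z : normedModType R) n (U : set W) (L : V -> W) (b : W) (f : W ->
  Z) :
  linear L -> continuous L -> open U -> Cn_on n U f ->
  Cn_on n [set x | U (L x + b)] (fun x => f (L x + b)).
Proof.
move=> lL cL oU.
have cA : continuous (fun x => L x + b).
  by move=> x; exact: (@Cn_on_affine V W 0 setT L b lL cL).
have oA : open [set x | U (L x + b)] by apply: open_comp => // x _; exact: cA.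
elim: n f => [|n IH] f /=.
  by move=> H x Ux; apply: (@continuous_comp _ _ _ (fun x => L x + b) f); [exact: cA | exact: H].
move=> [d H].
have dA x := is_diff_affine b x lL cL.
have dF x : U (L x + b) -> is_diff x (f \o (fun x => L x + b)) ('d f (L x + b) \o L).
  by move=> Ux; apply: is_diff_comp; apply: differentiableP; exact: d.
split=> [x /dF[] //|v]; apply: Cn_on_ext (IH _ (H (L v))) => // x Ux.
by rewrite (is_diff_derive v (dF x Ux)) /= deriveE //; exact: d.
Qed.

Lemma is_diff_rsqrt (x : R) : 0 < x ->
  is_diff x (fun s : R => (Num.sqrt s)^-1) (fun h => - 2^-1 * (Num.sqrt x)^-1 ^+ 3 * h).
Proof.
move=> x0; have s0 : Num.sqrt x != 0 by rewrite gt_eqF // sqrtr_gt0.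
have [ds es] := is_derive1_sqrt x0.
have dv := derivableV s0 ds.
have ev := deriveV s0 ds.
move/derivable1_diffP : (dv) => dd.
apply: DiffDef => //; apply/funext => h.
have -> : 'd (fun s : R => (Num.sqrt s)^-1) x h = 'D_h (fun s : R => (Num.sqrt s)^-1) x.
  by rewrite deriveE.
rewrite deriveE // -[in LHS](mulr1 h) linearZ /= -deriveE // ev es /GRing.scale /=.
have -> : x = Num.sqrt x ^+ 2 by rewrite sqr_sqrtr // ltW.
by rewrite sqrtr_sqr gtr0_norm ?sqrtr_gt0 //; field.
Qed.

Lemma Cn_on_mul (T : normedModType R) n (U : set T) (f g : T -> R) :
  open U -> Cn_on n U f -> Cn_on n U g -> Cn_on n U (fun x => f x * g x).
Proof. exact: (@Cn_on_scale T R^o). Qed.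

(* r = q^(-1/2) satisfies D r = - r^3 D q / 2, so smoothness propagates by induction. *)
Lemma Cn_on_rsqrt (V : normedModType R) n (U : set V) (q : V -> R) :
  open U -> (forall x, U x -> 0 < q x) -> Cn_on n U q ->
  Cn_on n U (fun x => (Num.sqrt (q x))^-1).
Proof.
move=> oU q0.
have dr x : U x -> differentiable q x ->
    is_diff x ((fun s : R => (Num.sqrt s)^-1) \o q)
      ((fun h => - 2^-1 * (Num.sqrt (q x))^-1 ^+ 3 * h) \o 'd q x).
  move=> Ux d; apply: is_diff_comp; first exact: differentiableP.
  exact/is_diff_rsqrt/q0.
elim: n => [|n IH] Hq.
  move=> /= x Ux; apply: (@continuous_comp _ _ _ q (fun s : R => (Num.sqrt s)^-1));
    first exact: Hq.
  by apply: differentiable_continuous; case: (is_diff_rsqrt (q0 x Ux)).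
have /= [d H] := Hq.
split=> [x Ux|v]; first by case: (dr x Ux (d x Ux)).
have Hr := IH (Cn_onW Hq).
have H3 := Cn_on_mul oU Hr (Cn_on_mul oU Hr Hr).
have := Cn_on_mul oU (Cn_on_cst n U (- 2^-1 : R)) (Cn_on_mul oU H3 (H v)).
apply: Cn_on_ext => // x Ux; rewrite (is_diff_derive v (dr x Ux (d x Ux))) /= deriveE;
  last exact: d.
ring.
Qed.

End SmoothCalculus.

(** * Tangent spaces of submanifolds *)

Section TangentSpaces.
Context {R : realType}.

Lemma local_parametrization_sub (V : normedModType R) k (M : set V) (U : set 'rV[R]_k) psi x :
  local_parametrization M U psi -> U x -> M (psi x).
Proof.
move=> [oU _ _ _ /(_ U oU (@subset_refl _ U)) [N oN E]] Ux.
have [] : (M `&` N) (psi x) by rewrite -E; exists x.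
by [].
Qed.

(** The curve is the image under [psi] of the segment x + t a, which stays in [U] for small t. *)
Lemma tangent_space_diff (V : normedModType R) k (M : set V) (U : set 'rV[R]_k) psi x a :
  local_parametrization M U psi -> U x -> tangent_space M (psi x) ('d psi x a).
Proof.
move=> lp Ux; have [oU sm _ _ _] := lp.
have lL : linear (fun t : R^o => t *: a) by move=> c s t /=; rewrite scalerDl scalerA.
have cL : continuous (fun t : R^o => t *: a) by move=> t; apply: scalel_continuous.
have cA : continuous (fun t : R^o => t *: a + x).
  by move=> t; exact: (@Cn_on_affine R R^o _ 0 setT _ x lL cL).
have oA : open [set t : R^o | U (t *: a + x)] by apply: open_comp => // t _; exact: cA.
have /nbhs_ballP [e e0 He] : nbhs (0 : R^o) [set t : R^o | U (t *: a + x)].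
  by apply: open_nbhs_nbhs; split=> //=; rewrite scale0r add0r.
exists (fun t => psi (t *: a + x)), e; split=> //.
- by move=> n; have := @Cn_on_comp_affine R R^o _ _ n U _ x psi lL cL oU (sm n);
  exact: Cn_on_sub He.
- by move=> t /He /= Ut; exact: (local_parametrization_sub lp Ut).
- by rewrite scale0r add0r.
- have d : differentiable psi (0 *: a + x) by rewrite scale0r add0r; exact: (sm 1%N).1.
  have dA := is_diff_affine x (0 : R^o) lL cL.
  have := @is_diff_comp _ _ _ _ _ _ _ _ (0 : R^o) dA (differentiableP d).
  move=> /(is_diff_derive (1 : R^o)) /= ->.
  by rewrite scale1r scale0r add0r.
Qed.

(** The coordinates of the images of the unit vectors form a row-free matrix, and [pinvmx] inverts
    it on one side. The inverse is used to bound displacements in a chart by displacements in the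
    ambient space. *)
Lemma linear_left_inverse (V : normedModType R) k (f : {linear 'rV[R]_k -> V}) :
  has_coordinates V -> injective f ->
  exists L : V -> 'rV[R]_k, linear L /\ forall a, L (f a) = a.
Proof.
move=> [n [c [e [_ lc s]]]] injf.
pose N : 'M[R]_(k, n) := \matrix_(i, j) c j (f (delta_mx 0 i)).
have E a : \row_j c j (f a) = a *m N.
  apply/rowP => j; rewrite !mxE {1}[a]row_sum_delta linear_sum.
  rewrite -[LHS]/(pack_lin (lc j) (\sum_i f (a 0 i *: delta_mx 0 i))) linear_sum.
  by apply: eq_bigr => i _; rewrite !linearZ /= mxE.
have rf : row_free N.
  apply: inj_row_free => v vN; apply: injf; rewrite linear0 (s (f v)).
  apply: big1 => j _; have : (\row_j c j (f v)) 0 j = 0 by rewrite E vN mxE.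
  by rewrite mxE => ->; rewrite scale0r.
exists (fun u => (\row_j c j u) *m pinvmx N); split.
  move=> a u v; rewrite scalemxAl -mulmxDl; congr (_ *m _).
  by apply/rowP => j; rewrite !mxE; exact: lc.
by move=> a; rewrite E -mulmxA mulmxVp // mulmx1.
Qed.

(* A curve in the chart is psi(x + h t) with h t -> 0. A linear left inverse of
   d psi shows that h t = O(t), so that the velocity is in the image of d psi. *)
Lemma tangent_space_sub_diff (V : normedModType R) k (M : set V) (U : set 'rV[R]_k) psi x v :
  has_coordinates V -> local_parametrization M U psi -> U x ->
  tangent_space M (psi x) v -> exists a, v = 'd psi x a.
Proof.
move=> fV lp Ux [gamma [e [e0 smg Mg g0 gv]]]; have [oU sm inj injd opn] := lp.
have dpsi : differentiable psi x by exact: (sm 1%N).1.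
have b0 : ball (0 : R) e 0 by exact: ballxx.
have dg : differentiable gamma 0 by exact: (smg 1%N).1.
have [L [lL LK]] := linear_left_inverse fV (injd x Ux).
have cL := linear_finite_continuous fV lL.
pose Q u := u - 'd psi x (L u).
have lQ : linear Q.
  by move=> a u w; rewrite /Q lL linearD linearZ /= scalerBr opprD addrACA.
have cQ := linear_finite_continuous fV lQ.
have QK a : Q ('d psi x a) = 0 by rewrite /Q LK subrr.
suff Qv : Q v = 0 by exists (L v); apply/eqP; rewrite -subr_eq0 -/(Q v) Qv.
have [CL CL0 HL] := linear_lipschitz (f := pack_lin lL) cL.
have [CQ CQ0 HQ] := linear_lipschitz (f := pack_lin lQ) cQ.
rewrite /= in HL HQ.
pose K := CQ * (2 * CL * (`|v| + 1)) + CQ.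
have K0 : 0 < K by rewrite ltr_wpDl // !mulr_ge0 // ?ltW // ?addr_ge0.
(* The bound eps <= 1 keeps the difference quotient of gamma below |v| + 1. The bound on 2 CL eps
   lets the remainder of psi be absorbed when the displacement h in the chart is estimated. *)
suff H eps : 0 < eps -> eps <= 1 -> 2 * CL * eps <= 1 -> `|Q v| <= K * eps.
  apply/eqP; rewrite -normr_le0; apply/ler_addgt0Pr => d d0; rewrite add0r.
  pose eps := Num.min (d / K) (Num.min 1 (2 * CL)^-1).
  have p1 : 0 < eps by rewrite !lt_min divr_gt0 //= ltr01 /= invr_gt0 mulr_gt0.
  have p2 : eps <= 1 by rewrite /eps !ge_min lexx orbT.
  have p3 : 2 * CL * eps <= 1.
    by rewrite mulrC -ler_pdivlMr ?mulr_gt0 // mul1r /eps !ge_min lexx !orbT.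
  apply: (le_trans (H eps p1 p2 p3)).
  by rewrite mulrC -ler_pdivlMr // /eps ge_min lexx.
move=> ep ep1 epC.
have lQB u w : Q (u - w) = Q u - Q w by exact: (linearB (pack_lin lQ)).
have lQZ a u : Q (a *: u) = a *: Q u by exact: (linearZ_LR (pack_lin lQ)).
have lQD u w : Q (u + w) = Q u + Q w by exact: (linearD (pack_lin lQ)).
have lLD u w : L (u + w) = L u + L w by exact: (linearD (pack_lin lL)).
have /eqaddoP/(_ eps ep)/nbhs_ballP [/= d d0 Hd] := diff_locally dpsi.
have /eqaddoP/(_ eps ep) Hg := diff_locally dg.
pose U' := U `&` ball x d.
(* Since psi is open onto M, gamma t is for small t the image of a chart point within d of x: the
   curve cannot approach [psi x] along another sheet of M. *)
have [N oN EN] := opn U' (openI oU (ball_open x d)) (@subIsetl _ _ _).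
have nO : \forall t \near (0 : R), N (gamma t).
  apply: (differentiable_continuous dg); apply: open_nbhs_nbhs; split=> //.
  have : (M `&` N) (gamma 0).
    by rewrite g0 -EN; exists x => //; split=> //; exact: ballxx.
  by case.
have nM : \forall t \near (0 : R), M (gamma t).
  by apply: filterS (nbhsx_ballx (0 : R) e e0) => t; exact: Mg.
have /nbhs_ballP [r /= r0 Hr] : \forall t \near (0 : R), [/\ N (gamma t), M (gamma t) &
    `|(gamma \o shift 0 - (cst (gamma 0) + 'd gamma 0)) t| <= eps * `|t| ].
  by near=> t; split; near: t.
pose t := r / 2.
have t0 : t != 0 by rewrite mulf_neq0 // gt_eqF.
have [Ot Mt Ht] : [/\ N (gamma t), M (gamma t) &
    `|(gamma \o shift 0 - (cst (gamma 0) + 'd gamma 0)) t| <= eps * `|t| ].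
  apply: Hr; rewrite -ball_normE /= sub0r normrN gtr0_norm ?divr_gt0 //.
  by rewrite /t; lra.
have [y [Uy By] Ey] : (psi @` U') (gamma t) by rewrite EN.
pose h := y - x.
have hd : ball 0 d h by move: By; rewrite -!ball_normE /= sub0r opprB.
have := Hd h hd; rewrite /= -[X in `|X|]/(psi (h + x) - (psi x + 'd psi x h)) subrK Ey.
set D := gamma t - _ => HD.
have EG : gamma t - psi x = 'd psi x h + D by rewrite /D opprD [gamma t + (_ +
  _)]addrA addrCA subrr addr0.
have Eh : h = L (gamma t - psi x) - L D by rewrite EG lLD LK addrK.
set Gm := gamma t - psi x in EG Eh.
(* By [Eh] and |D| <= eps |h|, h is bounded by CL |Gm| + CL eps |h|, and the last term is at most
   |h| / 2. *)
have hG : `|h| <= 2 * CL * `|Gm|.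
  have h1 : `|h| <= CL * `|Gm| + CL * (eps * `|h|).
    rewrite {1}Eh; apply: le_trans (ler_normB _ _) _; apply: lerD; first exact: HL.
    by apply: le_trans (HL _) _; rewrite ler_pM2l.
  have h2 : 2 * CL * eps * `|h| <= `|h| by rewrite ler_piMl.
  nra.
move: Ht; rewrite -[X in `|X|]/(gamma (t + 0) - (gamma 0 + 'd gamma 0 t)) addr0 g0.
have -> : 'd gamma 0 t = t *: v.
  by rewrite -gv deriveE // -linearZ /= /GRing.scale /= mulr1.
rewrite opprD addrA -/Gm => Ht.
have QG : Q Gm = Q D by rewrite EG lQD QK add0r.
have tp : 0 < `|t| by rewrite normr_gt0.
have Gb : `|Gm| <= (`|v| + 1) * `|t|.
  rewrite -[Gm](subrK (t *: v)); apply: le_trans (ler_normD _ _) _.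
  rewrite normrZ; nra.
have : `|Q (t *: v)| <= K * eps * `|t|.
  rewrite -[t *: v](subKr Gm) lQB QG.
  apply: le_trans (ler_normB _ _) _.
  have a1 : `|Q D| <= CQ * (eps * (2 * CL * ((`|v| + 1) * `|t|))).
    apply: le_trans (HQ _) _; rewrite ler_pM2l //; apply: (le_trans HD).
    rewrite ler_pM2l //; apply: (le_trans hG); rewrite ler_pM2l //; lra.
  have a2 : `|Q (Gm - t *: v)| <= CQ * (eps * `|t|).
    by apply: le_trans (HQ _) _; rewrite ler_pM2l.
  apply: le_trans (lerD a1 a2) _.
  rewrite le_eqVlt; apply/orP; left; apply/eqP; rewrite /K; ring.
by rewrite lQZ normrZ mulrC ler_pM2r.
Unshelve. all: by end_near. Qed.

End TangentSpaces.

(** * Quaternionic structure and the Hopf fibration *)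

Section QuaternionicAlgebra.
Context {R : realType}.
Local Notation C4 := (C4 R).
Local Notation CM4 := (CM4 R).
Local Notation g := (@g R).
Local Notation I1 := (@I_ R 0).
Local Notation I2 := (@I_ R 1).
Local Notation I3 := (@I_ R 2%:R).

Lemma trmx_J : (J R)^T = - J R.
Proof.
have J'T : (J' R)^T = - J' R by apply/matrixP => i j; rewrite !mxE opprB.
have H : (block_mx (J' R) 0 0 (J' R))^T = - block_mx (J' R) 0 0 (J' R).
  by rewrite tr_block_mx !trmx0 J'T opp_block_mx !oppr0.
exact: H.
Qed.

Lemma mulmx_JJ : J R *m J R = - 1%:M.
Proof.
have J'J : J' R *m J' R = - 1%:M.
  apply/matrixP => i j; rewrite !mxE !big_ord_recl big_ord0 !mxE /=.
  by case: i => [[|[|i]] Hi] //; case: j => [[|[|j]] Hj] //=; rewrite /=; ring.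
have H : block_mx (J' R) 0 0 (J' R) *m block_mx (J' R) 0 0 (J' R) = - 1%:M.
  rewrite mulmx_block !mulmx0 !mul0mx !addr0 add0r J'J.
  by rewrite (@scalar_mx_block _ 2 2) opp_block_mx !oppr0.
exact: H.
Qed.

Lemma I1E u : I1 u = (- u.2, u.1).
Proof. by rewrite /I_ /quat_act /Defs.cscale /=; congr pair;
  rewrite /= !scale0r !scale1r ?add0r ?addr0 ?oppr0 ?addr0. Qed.

Lemma I2E u : I2 u = (J R *m u.1, - (J R *m u.2)).
Proof. by rewrite /I_ /quat_act /Defs.cscale /=; congr pair;
  rewrite /= !scale0r !scale1r ?add0r ?addr0 ?oppr0 ?addr0 ?add0r ?addr0. Qed.

Lemma I3E u : I3 u = (J R *m u.2, J R *m u.1).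
Proof.
rewrite /I_ /quat_act /Defs.cscale /=; congr pair; rewrite /= !scale0r !scale1r ?opprK.
  by rewrite subr0 !add0r.
by rewrite addr0 !add0r.
Qed.

Lemma gE u v : g u v = (u.1^T *m v.1) 0 0 + (u.2^T *m v.2) 0 0.
Proof.
rewrite !mxE /g big_split /=; congr (_ + _); apply: eq_bigr => i _; by rewrite !mxE.
Qed.

Lemma gC u v : g u v = g v u.
Proof. by rewrite /g; apply: eq_bigr => l _; ring. Qed.

Lemma g_linear u : linear (g u : C4 -> R^o).
Proof.
move=> a v w; rewrite /g /GRing.scale /= mulr_sumr -big_split /=.
by apply: eq_bigr => l _; rewrite !mxE; ring.
Qed.

Lemma gDr u v w : g u (v + w) = g u v + g u w.
Proof. by have := g_linear u 1 v w; rewrite scale1r => ->; rewrite scale1r. Qed.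
Lemma gZr a u v : g u (a *: v) = a * g u v.
Proof. exact: (linearZ_LR (pack_lin (g_linear u))). Qed.
Lemma gNr u v : g u (- v) = - g u v.
Proof. by rewrite -scaleN1r gZr mulN1r. Qed.
Lemma g0r u : g u 0 = 0.
Proof. by rewrite -[0](scale0r 0) gZr mul0r. Qed.
Lemma gDl u v w : g (v + w) u = g v u + g w u.
Proof. by rewrite gC gDr !(gC u). Qed.
Lemma gZl a u v : g (a *: v) u = a * g v u.
Proof. by rewrite gC gZr gC. Qed.
Lemma gNl u v : g (- v) u = - g v u.
Proof. by rewrite gC gNr gC. Qed.
Lemma g0l u : g 0 u = 0.
Proof. by rewrite gC g0r. Qed.

Lemma g_ge0 u : 0 <= g u u.
Proof. by rewrite /g sumr_ge0 // => l _; rewrite addr_ge0 // -expr2 sqr_ge0. Qed.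

Lemma g_eq0 u : g u u = 0 -> u = 0.
Proof.
move=> H; have H' l : (u.1 l 0 * u.1 l 0 + u.2 l 0 * u.2 l 0) = 0.
  move/eqP: H; rewrite /g psumr_eq0; last first.
    by move=> i _; rewrite addr_ge0 // -expr2 sqr_ge0.
  by move=> /allP /(_ l (mem_index_enum _)) /eqP.
case: u H H' => a b _ /= H; congr pair; apply/colP => l; rewrite mxE;
  have /eqP := H l; rewrite paddr_eq0 -?expr2 ?sqr_ge0 // !sqrf_eq0 => /andP[/eqP ? /eqP ?] //.
Qed.

Lemma I1_linear : linear I1.
Proof. by move=> a u v; rewrite !I1E /=; congr pair; rewrite /= ?scalerN ?opprD. Qed.
Lemma I2_linear : linear I2.
Proof.
by move=> a u v; rewrite !I2E /=; congr pair;
  rewrite /= ?mulmxDr ?scalemxAr // opprD scalerN scalemxAr.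
Qed.
Lemma I3_linear : linear I3.
Proof. by move=> a u v; rewrite !I3E /=; congr pair; rewrite /= mulmxDr scalemxAr. Qed.

Lemma I_linear i : linear (@I_ R i).
Proof.
case: i => [[|[|[|//]]] Hi] a u v.
- by have := I1_linear a u v.
- by have := I2_linear a u v.
- by have := I3_linear a u v.
Qed.

Lemma I_D i (u v : C4) : I_ i (u + v) = I_ i u + I_ i v.
Proof. exact: (linearD (pack_lin (I_linear i))). Qed.
Lemma I_N i (u : C4) : I_ i (- u) = - I_ i u.
Proof. exact: (linearN (pack_lin (I_linear i))). Qed.
Lemma I_Z i a (u : C4) : I_ i (a *: u) = a *: I_ i u.
Proof. exact: (linearZ_LR (pack_lin (I_linear i))). Qed.

Lemma I11 u : I1 (I1 u) = - u.
Proof. by rewrite !I1E; case: u. Qed.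
Lemma I22 u : I2 (I2 u) = - u.
Proof.
by rewrite !I2E /= mulmxN !mulmxA mulmx_JJ !mulNmx !mul1mx opprK; case: u.
Qed.
Lemma I12 u : I1 (I2 u) = I3 u.
Proof. by rewrite I1E I2E I3E /= opprK. Qed.
Lemma I21 u : I2 (I1 u) = - I3 u.
Proof. by rewrite I1E I2E I3E /= mulmxN. Qed.
Lemma I13 u : I1 (I3 u) = - I2 u.
Proof. by rewrite -[I3 u]I12 I11. Qed.
Lemma I23 u : I2 (I3 u) = I1 u.
Proof. by rewrite -(opprK (I3 u)) -I21 I_N I22 opprK. Qed.
Lemma I33 u : I3 (I3 u) = - u.
Proof. by rewrite -[LHS]I12 I23 I11. Qed.
Lemma g_I1 u v : g (I1 u) v = - g u (I1 v).
Proof. by rewrite !I1E /g -sumrN; apply: eq_bigr => l _ /=; rewrite !mxE; ring. Qed.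
Lemma g_I2 u v : g (I2 u) v = - g u (I2 v).
Proof.
have H (a b : 'cV[R]_4) : (J R *m a)^T *m b = - (a^T *m (J R *m b)).
  by rewrite trmx_mul trmx_J mulmxN mulNmx mulmxA.
have mxN (A : 'M[R]_1) : (- A) 0 0 = - A 0 0 by rewrite mxE.
by rewrite !I2E !gE /= [(- _)^T]linearN /= mulNmx mulmxN !H !mxN; ring.
Qed.
Lemma g_I3 u v : g (I3 u) v = - g u (I3 v).
Proof. by rewrite -I12 g_I1 g_I2 opprK I21 gNr. Qed.

Lemma g_I i u v : g (I_ i u) v = - g u (I_ i v).
Proof.
case: i => [[|[|[|//]]] Hi].
- by have := g_I1 u v.
- by have := g_I2 u v.
- by have := g_I3 u v.
Qed.

Lemma g_I_self i u : g (I_ i u) u = 0.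
Proof. by have := g_I i u u; rewrite [g u _]gC => /eqP;
  rewrite -addr_eq0 -mulr2n mulrn_eq0 /= => /eqP. Qed.

(* [outer u v] is u v^*, and [dp1 z] is the differential of p1 at z. *)
Definition outer (u v : C4) : CM4 :=
  (u.1 *m v.1^T + u.2 *m v.2^T, u.2 *m v.1^T - u.1 *m v.2^T).

Definition dp1 (z w : C4) : CM4 := outer z w + outer w z.

Definition cmulv (X : CM4) (u : C4) : C4 :=
  (X.1 *m u.1 - X.2 *m u.2, X.1 *m u.2 + X.2 *m u.1).

Lemma p1E z : p1 z = outer z z.
Proof. by []. Qed.

Lemma outer_linearr u : linear (outer u).
Proof.
move=> a v w; rewrite /outer; congr pair; apply/matrixP => i j;
  rewrite !mxE !big_ord1 !mxE; ring.
Qed.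

Lemma outer_linearl v : linear (outer^~ v).
Proof.
move=> a u w; rewrite /outer; congr pair; apply/matrixP => i j;
  rewrite !mxE !big_ord1 !mxE; ring.
Qed.

Lemma outerDr u v w : outer u (v + w) = outer u v + outer u w.
Proof. exact: (linearD (pack_lin (outer_linearr u))). Qed.
Lemma outerDl u v w : outer (v + w) u = outer v u + outer w u.
Proof. exact: (linearD (pack_lin (outer_linearl u))). Qed.
Lemma outerZr a u v : outer u (a *: v) = a *: outer u v.
Proof. exact: (linearZ_LR (pack_lin (outer_linearr u))). Qed.
Lemma outerZl a u v : outer (a *: v) u = a *: outer v u.
Proof. exact: (linearZ_LR (pack_lin (outer_linearl u))). Qed.

Lemma outer_I1 u v : outer (I1 u) (I1 v) = outer u v.
Proof.
rewrite !I1E /outer /=; congr pair; apply/matrixP => i j;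
  rewrite !mxE !big_ord1 !mxE; ring.
Qed.

Lemma dp1_linear u : linear (dp1 u).
Proof.
by move=> a v w; rewrite /dp1 outer_linearr (outer_linearl u a v w) scalerDr addrACA.
Qed.
Lemma dp1C u v : dp1 u v = dp1 v u.
Proof. by rewrite /dp1 addrC. Qed.
Lemma dp1Dr u v w : dp1 u (v + w) = dp1 u v + dp1 u w.
Proof. exact: (linearD (pack_lin (dp1_linear u))). Qed.
Lemma dp1Nr u v : dp1 u (- v) = - dp1 u v.
Proof. exact: (linearN (pack_lin (dp1_linear u))). Qed.
Lemma dp1Zr a u v : dp1 u (a *: v) = a *: dp1 u v.
Proof. exact: (linearZ_LR (pack_lin (dp1_linear u))). Qed.
Lemma dp1r0 z : dp1 z 0 = 0.
Proof. by have := dp1Zr 0 z 0; rewrite !scale0r. Qed.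
Lemma dp1_I1 u v : dp1 (I1 u) (I1 v) = dp1 u v.
Proof. by rewrite /dp1 !outer_I1. Qed.
(** The direction [I1 u] is tangent to the Hopf circle. Invariance under [I1] and symmetry of [dp1]
    show that the vector equals its opposite. *)
Lemma dp1_I1_self u : dp1 u (I1 u) = 0.
Proof.
have := dp1_I1 u (I1 u); rewrite I11 dp1Nr dp1C => /eqP.
by rewrite eq_sym -addr_eq0 -mulr2n -scaler_nat scaler_eq0 pnatr_eq0 /= => /eqP.
Qed.

Lemma p1Z a (u : C4) : p1 (a *: u) = a ^+ 2 *: p1 u.
Proof.
by rewrite !p1E outerZl outerZr scalerA expr2.
Qed.

Lemma p1D (u v : C4) : p1 (u + v) = p1 u + dp1 u v + p1 v.
Proof. by rewrite !p1E /dp1 outerDl !outerDr !addrA. Qed.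

Lemma p1_I1 u : p1 (I1 u) = p1 u.
Proof. by rewrite !p1E outer_I1. Qed.

(** The trace of a b^* d c^* is (c^* a) (b^* d), and the real part of this product is expanded with
    u^* v = [g u v] + i [g (I1 u) v]. *)
Lemma fubini_study_outer a b c d : fubini_study (outer a b) (outer c d) =
  2^-1 * (g a c * g b d - g (I1 c) a * g (I1 b) d).
Proof.
congr (_ * _); rewrite !I1E /g !big_distrlr -sumrB; apply: eq_bigr => k _.
rewrite -sumrB; apply: eq_bigr => l _.
by rewrite /= !mxE !big_ord1 !mxE; ring.
Qed.

Lemma outer1E a b i j : (outer a b).1 i j = a.1 i 0 * b.1 j 0 + a.2 i 0 * b.2 j 0.
Proof. by rewrite !mxE !big_ord1 !mxE. Qed.
Lemma outer2E a b i j : (outer a b).2 i j = a.2 i 0 * b.1 j 0 - a.1 i 0 * b.2 j 0.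
Proof. by rewrite !mxE !big_ord1 !mxE. Qed.

(** In complex notation: a b^* c d^* = (b^* c) a d^*. *)
Lemma cmulmx_outer a b c d : cmulmx (outer a b) (outer c d) =
  outer (Defs.cscale (g b c, g (I1 b) c) a) d.
Proof.
have cs1 x y l : (Defs.cscale (x, y) a).1 l 0 = x * a.1 l 0 - y * a.2 l 0 by rewrite /= !mxE.
have cs2 x y l : (Defs.cscale (x, y) a).2 l 0 = x * a.2 l 0 + y * a.1 l 0 by rewrite /= !mxE.
rewrite /cmulmx; apply: injective_projections; apply/matrixP => i j.
  rewrite outer1E cs1 cs2 /= [LHS]mxE [X in _ + X]mxE.
  have m1 (A B : 'M[R]_4) : (A *m B) i j = \sum_k A i k * B k j by rewrite mxE.
  rewrite !m1 -sumrB I1E /g !mulr_suml -sumrB !mulr_suml -big_split /=.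
  by rewrite !mulr_suml -big_split; apply: eq_bigr => k _; rewrite /= !outer1E !outer2E !mxE;
    ring.
rewrite outer2E cs1 cs2 /= [LHS]mxE.
have m1 (A B : 'M[R]_4) : (A *m B) i j = \sum_k A i k * B k j by rewrite mxE.
rewrite !m1 -big_split I1E /g !mulr_suml -big_split -sumrB !mulr_suml -sumrB.
by apply: eq_bigr => k _; rewrite /= !outer1E !outer2E !mxE; ring.
Qed.

Lemma cmulv_outer a b u : cmulv (outer a b) u = Defs.cscale (g b u, g (I1 b) u) a.
Proof.
rewrite /cmulv /Defs.cscale; congr pair; apply/colP => i; rewrite I1E /g /= !mxE.
  rewrite -sumrB !mulr_suml -sumrB.
  by apply: eq_bigr => k _; rewrite /= !outer1E !outer2E !mxE; ring.
rewrite -big_split !mulr_suml -big_split.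
by apply: eq_bigr => k _; rewrite /= !outer1E !outer2E !mxE; ring.
Qed.

Lemma cscaleE a u : Defs.cscale a u = a.1 *: u + a.2 *: I1 u.
Proof.
by rewrite I1E; apply: injective_projections; rewrite //= scalerN.
Qed.

(** [I2 u] is J times the conjugate of u. Hence the conjugate of u v^* placed between J and [J^T] is
    the outer product of [I2 u] and [I2 v]. *)
Lemma p2_outer u v : p2 (outer u v) = outer u v + outer (I2 u) (I2 v).
Proof.
have tN (A : 'cV[R]_4) : (- A)^T = - A^T by apply/matrixP => i j; rewrite !mxE.
rewrite !I2E; apply: injective_projections; rewrite /= !tN !trmx_mul.
  by rewrite mulmxDr mulmxDl !mulNmx mulmxN opprK !mulmxA.
rewrite mulmxBr mulmxBl !mulNmx mulmxN !mulmxA opprK opprB.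
by congr (_ + _); rewrite addrC.
Qed.

End QuaternionicAlgebra.

(** * Local sections of the Hopf fibration, and [p1] as a Riemannian submersion *)

Section ProjectiveSpace.
Context {R : realType}.
Local Notation C4 := (C4 R).
Local Notation CM4 := (CM4 R).
Local Notation g := (@g R).
Local Notation I1 := (@I_ R 0).
Local Notation I2 := (@I_ R 1).
Local Notation I3 := (@I_ R 2%:R).

Lemma g_I1I1 (u v : C4) : g (I1 u) (I1 v) = g u v.
Proof. by rewrite g_I1 I11 gNr opprK. Qed.

Lemma has_coordinates_C4 : has_coordinates C4.
Proof. by apply: has_coordinates_prod; exact: has_coordinates_mx. Qed.
Lemma has_coordinates_CM4 : has_coordinates CM4.
Proof. by apply: has_coordinates_prod; exact: has_coordinates_mx. Qed.

Lemma g_linearl v : linear (fun u => g u v : R^o).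
Proof. by move=> a u w; rewrite !(gC _ v); exact: g_linear. Qed.

Lemma g_continuous : continuous (fun p : C4 * C4 => g p.1 p.2 : R^o).
Proof.
exact: (bilinear_finite_continuous has_coordinates_C4 has_coordinates_C4 g_linearl (@g_linear R)).
Qed.

Lemma outer_continuous : continuous (fun p : C4 * C4 => outer p.1 p.2).
Proof.
exact: (bilinear_finite_continuous has_coordinates_C4 has_coordinates_C4
  (@outer_linearl R) (@outer_linearr R)).
Qed.

Lemma cmulv_linear (z : C4) : linear (cmulv^~ z).
Proof.
move=> a X Y; apply: injective_projections => /=.
  by rewrite !mulmxDl -!scalemxAl scalerBr opprD addrACA.
by rewrite !mulmxDl -!scalemxAl scalerDr addrACA.
Qed.

Lemma cmulv_continuous (z : C4) : continuous (cmulv^~ z).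
Proof. exact: (linear_finite_continuous has_coordinates_CM4 (cmulv_linear z)). Qed.

Lemma Cn_on_p1 (T : normedModType R) n (U : set T) (f : T -> C4) :
  open U -> Cn_on n U f -> Cn_on n U (fun x => p1 (f x)).
Proof.
move=> oU Hf; apply: (Cn_on_bilinear (@outer_linearl R) (@outer_linearr R) outer_continuous) =>
  //.
Qed.

Lemma Cn_on_g (T : normedModType R) n (U : set T) (f h : T -> C4) :
  open U -> Cn_on n U f -> Cn_on n U h -> Cn_on n U (fun x => g (f x) (h x)).
Proof.
move=> oU Hf Hh; exact: (Cn_on_bilinear g_linearl (@g_linear R) g_continuous).
Qed.

Lemma is_diff_p1 (T : normedModType R) (f df : T -> C4) x :
  is_diff x f df -> is_diff x (fun y => p1 (f y)) (fun h => dp1 (f x) (df h)).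
Proof.
move=> H; have := is_diff_bilinear (@outer_linearl R) (@outer_linearr R) outer_continuous H H.
by under [X in is_diff_def _ _ X]eq_fun do rewrite addrC.
Qed.

Lemma is_diff_g (T : normedModType R) (f df h dh : T -> C4) x :
  is_diff x f df -> is_diff x h dh ->
  is_diff x (fun y => g (f y) (h y)) (fun k => g (df k) (h x) + g (f x) (dh k)).
Proof. exact: (is_diff_bilinear g_linearl (@g_linear R) g_continuous). Qed.

(** Differentiating the constant [g (f y) (f y)] gives twice the claim. *)
Lemma diff_unit_perp (T : normedModType R) (f df : T -> C4) x k :
  (\forall y \near x, S7 (f y)) -> is_diff x f df -> g (f x) (df k) = 0.
Proof.
move=> H D; have := is_diff_g D D.
have n1 : {near x, (fun y => g (f y) (f y)) =1 cst 1} by exact: H.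
move=> /(is_diff_near_eq n1) [_].
rewrite diff_cst => /(congr1 (fun F => F k)) /= E.
have : 2 * g (f x) (df k) = 0 by rewrite mulr2n mulrDl mul1r {1}gC -E.
by move/eqP; rewrite mulf_eq0 pnatr_eq0 /= => /eqP.
Qed.

(* For unit z, a section of p1 over the open set where <z, Q z> > 0, with value z at p1 z. *)
Definition hopf_section (z : C4) (Q : CM4) : C4 :=
  (Num.sqrt (g z (cmulv Q z)))^-1 *: cmulv Q z.

Lemma p1_combination a b (u : C4) : p1 (a *: u + b *: I1 u) = (a ^+ 2 + b ^+ 2) *: p1 u.
Proof. by rewrite p1D dp1Zr dp1C dp1Zr dp1C dp1_I1_self !scaler0 addr0 !p1Z p1_I1 scalerDl. Qed.

Lemma cmulv_p1 (u z : C4) : cmulv (p1 u) z = g u z *: u + g (I1 u) z *: I1 u.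
Proof. by rewrite p1E cmulv_outer cscaleE. Qed.

Lemma g_cmulv_p1 (u z : C4) : g z (cmulv (p1 u) z) = g u z ^+ 2 + g (I1 u) z ^+ 2.
Proof. by rewrite cmulv_p1 gDr !gZr !(gC z); ring. Qed.

(** For Q = u u^* the vector Q z is (u^* z) u. Both its squared norm and <z, Q z> equal |u^* z|^2,
    so dividing by the square root of the latter gives a unit vector on the line of Q. *)
Lemma hopf_sectionP z Q : CP3 Q -> 0 < g z (cmulv Q z) ->
  S7 (hopf_section z Q) /\ p1 (hopf_section z Q) = Q.
Proof.
move=> [u Su <-] q0; rewrite /hopf_section.
set q := g z _ in q0 *.
have s2 : (Num.sqrt q)^-1 ^+ 2 * q = 1.
  by rewrite exprVn sqr_sqrtr ?mulVf ?gt_eqF // ltW.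
have qE : q = g u z ^+ 2 + g (I1 u) z ^+ 2 by exact: g_cmulv_p1.
split.
  rewrite /S7 /= gZl gZr mulrA -expr2 -[RHS]s2; congr (_ * _).
  rewrite qE cmulv_p1 !gDl !gDr !gZl !gZr (gC u (I1 u)) g_I_self g_I1I1 Su; ring.
by rewrite p1Z cmulv_p1 p1_combination -qE scalerA s2 scale1r.
Qed.

Lemma hopf_section_p1 z : S7 z -> hopf_section z (p1 z) = z.
Proof.
move=> Sz; rewrite /hopf_section g_cmulv_p1 cmulv_p1 g_I_self Sz expr1n expr0n /=.
by rewrite addr0 sqrtr1 invr1 !scale1r scale0r addr0.
Qed.

Lemma Cn_on_hopf_section (T : normedModType R) n (U : set T) (f : T -> CM4) z :
  open U -> (forall x, U x -> 0 < g z (cmulv (f x) z)) -> Cn_on n U f ->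
  Cn_on n U (fun x => hopf_section z (f x)).
Proof.
move=> oU q0 Hf.
have Hv : Cn_on n U (fun x => cmulv (f x) z).
  exact: (Cn_on_linear (cmulv_linear z) (@cmulv_continuous z)).
apply: Cn_on_scale => //; apply: Cn_on_rsqrt => //.
by apply: Cn_on_g => //; exact: Cn_on_cst.
Qed.

(** The Hermitian complement of z, that is the horizontal space of [p1]. It is larger than
    [horizontal] below, which is horizontal for the quaternionic fibration. *)
Definition cperp (z w : C4) := g z w = 0 /\ g (I1 z) w = 0.

Lemma fubini_study_Dl (X Y Z : CM4) : fubini_study (X + Y) Z = fubini_study X Z +
  fubini_study Y Z.
Proof.
rewrite /fubini_study -mulrDr -big_split; congr (_ * _); apply: eq_bigr => k _.
by rewrite -big_split; apply: eq_bigr => l _; rewrite /= !mxE; ring.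
Qed.

Lemma fubini_studyC (X Y : CM4) : fubini_study X Y = fubini_study Y X.
Proof.
by congr (_ * _); apply: eq_bigr => k _; apply: eq_bigr => l _; ring.
Qed.

Lemma fubini_study0 (X : CM4) : fubini_study X 0 = 0.
Proof.
rewrite /fubini_study big1 ?mulr0 // => k _; rewrite big1 // => l _.
by rewrite /= !mxE !mulr0 addr0.
Qed.

Lemma fubini_study_dp1 (a b c d : C4) : fubini_study (dp1 a b) (dp1 c d) =
  g a c * g b d + g a d * g b c - g (I1 c) a * g (I1 b) d - g (I1 d) a * g (I1 b) c.
Proof.
rewrite /dp1 fubini_study_Dl !(fubini_studyC _ (outer c d + _)) !fubini_study_Dl.
rewrite !fubini_study_outer !(g_I1 d) !(g_I1 c) !(gC d) !(gC c) (gC (I1 b)) (gC (I1 a)).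
by field.
Qed.

(** Expresses that [p1] is a Riemannian submersion; injectivity of [dp1 z] on [cperp z] is deduced
    from it. *)
Lemma fubini_study_cperp z w w' : S7 z -> cperp z w -> cperp z w' ->
  fubini_study (dp1 z w) (dp1 z w') = g w w'.
Proof.
move=> Sz [w1 w2] [v1 v2]; rewrite fubini_study_dp1 Sz (gC w z) w1 v1 g_I_self.
by rewrite (g_I1 w' z) (gC w') v2; ring.
Qed.

Lemma dp1_inj z w w' : S7 z -> cperp z w -> cperp z w' -> dp1 z w = dp1 z w' -> w = w'.
Proof.
move=> Sz [w1 w2] [v1 v2] E; apply/eqP; rewrite -subr_eq0; apply/eqP/g_eq0.
have c : cperp z (w - w') by split; rewrite gDr gNr ?w1 ?w2 ?v1 ?v2 subrr.
by rewrite -(fubini_study_cperp Sz c c) !dp1Dr !dp1Nr E subrr fubini_study0.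
Qed.

(** The line z + t w projected radially to the sphere. Compared with a great circle it avoids
    trigonometric functions, its smoothness resting on [Cn_on_rsqrt]. *)
Definition sphere_curve (z w : C4) (t : R) : C4 :=
  (Num.sqrt (g (t *: w + z) (t *: w + z)))^-1 *: (t *: w + z).

Lemma sphere_curve_norm z w t : S7 z -> g z w = 0 ->
  g (t *: w + z) (t *: w + z) = 1 + t ^+ 2 * g w w.
Proof. by move=> Sz zw; rewrite !gDl !gDr !gZl !gZr (gC w z) zw Sz; ring. Qed.

Lemma sphere_curveP z w : S7 z -> g z w = 0 ->
  [/\ smooth_on setT (sphere_curve z w), (forall t, S7 (sphere_curve z w t)),
      sphere_curve z w 0 = z & 'D_1 (sphere_curve z w) 0 = w].
Proof.
move=> Sz zw.
have q0 t : 0 < g (t *: w + z) (t *: w + z).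
  by rewrite sphere_curve_norm // ltr_pwDl // mulr_ge0 ?sqr_ge0 // g_ge0.
have lL : linear (fun t : R^o => t *: w) by move=> c s t /=; rewrite scalerDl scalerA.
have cL : continuous (fun t : R^o => t *: w) by move=> t; apply: scalel_continuous.
have oT := @openT R^o.
have Ha n : Cn_on n [set: R^o] (fun t : R^o => t *: w + z) by exact: Cn_on_affine.
have Hq n : Cn_on n [set: R^o] (fun t : R^o => (Num.sqrt (g (t *: w + z) (t *: w + z)))^-1).
  by apply: Cn_on_rsqrt => //; apply: Cn_on_g.
have sm n : Cn_on n [set: R^o] (sphere_curve z w) by apply: Cn_on_scale.
have c0 : sphere_curve z w 0 = z.
  by rewrite /sphere_curve scale0r add0r Sz sqrtr1 invr1 scale1r.
have cS t : S7 (sphere_curve z w t).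
  rewrite /S7 /= gZl gZr mulrA -expr2 exprVn sqr_sqrtr ?mulVf ?gt_eqF //; exact: ltW.
split=> //.
have d : differentiable (sphere_curve z w : R^o -> C4) 0 by exact: (sm 1%N).1.
(* By the Leibniz rule the velocity is l z + w, with l the derivative of the normalising factor.
   Orthogonality to z forces l = 0, so l need not be computed. *)
have perp : g z ('D_1 (sphere_curve z w) 0) = 0.
  rewrite deriveE // -{1}c0; apply: diff_unit_perp (differentiableP d).
  by apply: filterE.
have dq : differentiable (fun t : R^o => (Num.sqrt (g (t *: w + z) (t *: w + z)))^-1) 0.
  exact: (Hq 1%N).1.
have da := is_diff_affine z (0 : R^o) lL cL.
have l1 (v : C4) : linear (fun a : R^o => a *: v) by move=> c s t /=; rewrite scalerDl scalerA.
have l2 (a : R^o) : linear (fun v : C4 => a *: v).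
  by move=> c s t /=; rewrite scalerDr !scalerA mulrC.
have := is_diff_bilinear l1 l2 (@scale_continuous _ _) (differentiableP dq) da.
move=> /(is_diff_derive (1 : R^o)).
rewrite scale0r add0r Sz sqrtr1 invr1 !scale1r -/(sphere_curve z w).
set l := 'd _ _ _ => E.
rewrite [LHS]E; move: perp; rewrite [X in g z X]E gDr gZr Sz zw mulr1 addr0 => ->.
by rewrite scale0r add0r.
Qed.

End ProjectiveSpace.

(** * Tangent, vertical and horizontal spaces of [CP3], and the structure I1' *)

Section TangentProjectiveSpace.
Context {R : realType}.
Local Notation C4 := (C4 R).
Local Notation CM4 := (CM4 R).
Local Notation g := (@g R).
Local Notation I1 := (@I_ R 0).
Local Notation I2 := (@I_ R 1).
Local Notation I3 := (@I_ R 2%:R).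

Lemma p1_sphere_curve z w : S7 z -> g z w = 0 ->
  let c := fun t => p1 (sphere_curve z w t) in
  [/\ smooth_on (ball (0 : R) 1) c, (forall t, CP3 (c t)), c 0 = p1 z & 'D_1 c 0 = dp1 z w].
Proof.
move=> Sz zw /=; have [sm cS c0 dc] := sphere_curveP Sz zw; split.
- move=> n; apply: (@Cn_on_sub _ R^o _ n setT) => //.
  by apply: (@Cn_on_p1 _ R^o) => //; exact: openT.
- by move=> t; exists (sphere_curve z w t).
- by rewrite c0.
- have d : differentiable (sphere_curve z w : R^o -> C4) 0 by exact: (sm 1%N).1.
  by rewrite (is_diff_derive (1 : R^o) (is_diff_p1 (differentiableP d))) c0 -deriveE // dc.
Qed.

Lemma tangent_space_sub (V : normedModType R) (M N : set V) p :
  M `<=` N -> tangent_space M p `<=` tangent_space N p.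
Proof.
by move=> MN v [c [e [e0 sm Mc c0 dc]]]; exists c, e; split=> // t /Mc/MN.
Qed.

(** A curve of projectors through [p1 z] is lifted to [S7] by [hopf_section z], and its velocity is
    the image under [dp1 z] of that of the lift. The converse projects [sphere_curve]. *)
Lemma tangent_space_CP3 z X : S7 z ->
  tangent_space (@CP3 R) (p1 z) X <-> exists2 w, cperp z w & X = dp1 z w.
Proof.
move=> Sz; split; last first.
  move=> [w [w1 w2] ->]; have [sm cS c0 dc] := p1_sphere_curve Sz w1.
  by eexists; exists 1; split=> //.
move=> [c [e [e0 sm Mc c0 dc]]].
have cc : {for (0 : R^o), continuous c} by apply: (sm 0%N); exact: ballxx.
have cq : {for (0 : R^o), continuous (fun t : R^o => g z (cmulv (c t) z) : R^o)}.
  apply: (@continuous_comp _ _ _ c (fun Q => g z (cmulv Q z) : R^o)) => //.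
  have lq : linear (fun Q => g z (cmulv Q z) : R^o).
    by move=> a P Q; rewrite (cmulv_linear z) g_linear.
  exact: (linear_finite_continuous has_coordinates_CM4 lq).
(* Positivity of <z, Q z> at the base point persists for small t, so the section is defined along
   the curve. *)
have q0 : g z (cmulv (c 0) z) = 1.
  by rewrite c0 g_cmulv_p1 g_I_self Sz expr1n expr0n addr0.
have nq : \forall t \near (0 : R^o), 0 < g z (cmulv (c t) z).
  have := cq; rewrite /prop_for /continuous_at q0 => /cvgr_gt; apply; exact: ltr01.
have nb : \forall t \near (0 : R^o), ball (0 : R) e t by exact: nbhsx_ballx.
have /nbhs_ballP [r /= r0 Hr] : \forall t \near (0 : R^o),
    0 < g z (cmulv (c t) z) /\ ball (0 : R) e t by near=> t; split; near: t.
have Hs : Cn_on 1 (ball (0 : R^o) r) (fun t => hopf_section z (c t)).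
  apply: Cn_on_hopf_section; first exact: ball_open.
    by move=> t /Hr [].
  by apply: Cn_on_sub (sm 1%N) => t /Hr [].
have Sh t : ball (0 : R^o) r t -> S7 (hopf_section z (c t)) /\ p1 (hopf_section z (c t)) = c t.
  by move=> /Hr [q bt]; apply: hopf_sectionP => //; exact: Mc.
have d : differentiable (fun t : R^o => hopf_section z (c t)) 0.
  by apply: Hs.1; exact: ballxx.
have h0 : hopf_section z (c 0) = z by rewrite c0 hopf_section_p1.
pose v := 'd (fun t : R^o => hopf_section z (c t)) 0 1.
have zv : g z v = 0.
  have n1 : \forall t \near (0 : R^o), S7 (hopf_section z (c t)).
    by apply: filterS (nbhsx_ballx (0 : R^o) r r0) => t /Sh [].
  by have := diff_unit_perp (1 : R^o) n1 (differentiableP d); rewrite h0.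
have Xv : X = dp1 z v.
  have := is_diff_derive (1 : R^o) (is_diff_p1 (differentiableP d)); rewrite h0 -/v => <-.
  rewrite -dc.
  apply: near_eq_derive; apply: filterS (nbhsx_ballx (0 : R^o) r r0) => t /Sh [_ ->].
  by [].
(* The lift may drift along the Hopf circle; removing the component along [I1 z] does not change the
   image under [dp1 z]. *)
exists (v - g (I1 z) v *: I1 z).
  by split; rewrite gDr gNr gZr ?(gC z) ?g_I_self ?g_I1I1 ?Sz ?(gC v) ?zv ?mulr1 ?mulr0 ?subrr.
by rewrite dp1Dr dp1Nr dp1Zr dp1_I1_self scaler0 subr0.
Unshelve. all: by end_near. Qed.

Definition horizontal (z w : C4) :=
  [/\ g z w = 0, g (I1 z) w = 0, g (I2 z) w = 0 & g (I3 z) w = 0].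

Lemma cperp_vertical z a b : cperp z (a *: I2 z + b *: I3 z).
Proof.
split; first by rewrite gDr !gZr !(gC z) !g_I_self !mulr0 addr0.
by rewrite gDr !gZr !g_I1 I12 I13 gNr !(gC z) !g_I_self !oppr0 !mulr0 addr0.
Qed.

Lemma horizontal_cperp z w : horizontal z w -> cperp z w.
Proof. by case. Qed.

Lemma g_I2_I2 (u v : C4) : g (I2 u) (I2 v) = g u v.
Proof. by rewrite g_I2 I22 gNr opprK. Qed.
Lemma g_I3_I3 (u v : C4) : g (I3 u) (I3 v) = g u v.
Proof. by rewrite g_I3 I33 gNr opprK. Qed.
Lemma g_I2_I3 (u : C4) : g (I2 u) (I3 u) = 0.
Proof. by rewrite g_I2 I23 gC g_I_self oppr0. Qed.

Lemma cperp_decomposition z w : S7 z -> cperp z w ->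
  exists a b h, [/\ horizontal z h & w = a *: I2 z + b *: I3 z + h].
Proof.
move=> Sz [w1 w2]; exists (g (I2 z) w), (g (I3 z) w).
exists (w - (g (I2 z) w *: I2 z + g (I3 z) w *: I3 z)); split; last by rewrite addrC subrK.
have [v1 v2] := cperp_vertical z (g (I2 z) w) (g (I3 z) w).
split; rewrite gDr gNr ?v1 ?v2 ?w1 ?w2 ?subrr //.
  by rewrite gDr !gZr g_I2_I2 g_I2_I3 Sz mulr1 mulr0 addr0 subrr.
by rewrite gDr !gZr (gC (I3 z) (I2 z)) g_I3_I3 g_I2_I3 Sz mulr1 mulr0 add0r subrr.
Qed.

Lemma horizontal_vertical z a b h : horizontal z h -> g (a *: I2 z + b *: I3 z) h = 0.
Proof. by move=> [_ _ h2 h3]; rewrite gDl !gZl h2 h3 !mulr0 addr0. Qed.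

Lemma p2D (X Y : CM4) : p2 (X + Y) = p2 X + p2 Y.
Proof.
by apply: injective_projections; rewrite /= mulmxDr mulmxDl ?opprD addrACA.
Qed.
Lemma p2Z a (X : CM4) : p2 (a *: X) = a *: p2 X.
Proof.
by apply: injective_projections; rewrite /= -scalemxAr -scalemxAl -?scalerN -scalerDr.
Qed.
Lemma p2_linear : linear (@p2 R).
Proof. by move=> a X Y; rewrite p2D p2Z. Qed.

Lemma p2_dp1 (u v : C4) : p2 (dp1 u v) = dp1 u v + dp1 (I2 u) (I2 v).
Proof. by rewrite /dp1 p2D !p2_outer addrACA. Qed.
Lemma p2_p1 (u : C4) : p2 (p1 u) = p1 u + p1 (I2 u).
Proof. exact: p2_outer. Qed.

(** To first order, the complex line of z moves inside its quaternionic line. The two terms given by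
    [p2_dp1] cancel, by symmetry of [dp1] and its invariance under [I1]. *)
Lemma p2_vertical z a b : p2 (dp1 z (a *: I2 z + b *: I3 z)) = 0.
Proof.
rewrite p2_dp1 I_D !I_Z I22 I23 !dp1Dr !dp1Zr dp1Nr [dp1 (I2 z) z]dp1C.
rewrite -(dp1_I1 (I2 z)) I12 I11 dp1Nr [dp1 (I3 z) z]dp1C.
by move: (dp1 z (I2 z)) (dp1 z (I3 z)) => A B; rewrite !scalerN addrACA !subrr addr0.
Qed.

Lemma p1_vertical z a b : p1 (a *: I2 z + b *: I3 z) = (a ^+ 2 + b ^+ 2) *: p1 (I2 z).
Proof. by rewrite -I12 p1_combination. Qed.

(** z + t w stays in the quaternionic line of z, where [p2 (p1 u)] is |u|^2 times a fixed projector.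
    The normalisation cancels the factor 1 + t^2 (a^2 + b^2). *)
Lemma p2_p1_fiber z a b t : S7 z ->
  p2 (p1 (sphere_curve z (a *: I2 z + b *: I3 z) t)) = p2 (p1 z).
Proof.
move=> Sz; set w := _ + _; have [zw _] := cperp_vertical z a b.
have ww : g w w = a ^+ 2 + b ^+ 2.
  rewrite /w !gDl !gDr !gZl !gZr g_I2_I2 g_I3_I3 (gC (I3 z) (I2 z)) g_I2_I3 Sz; ring.
rewrite /sphere_curve p1Z p2Z p1D p2D [p2 (_ +
  dp1 _ _)]p2D dp1C dp1Zr p2Z p2_vertical scaler0 addr0 p1Z p2Z.
have -> : p2 (p1 w) = (a ^+ 2 + b ^+ 2) *: p2 (p1 z).
  have pN : p1 (- z) = p1 z by rewrite -scaleN1r p1Z sqrrN expr1n scale1r.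
  by rewrite /w p1_vertical p2Z !p2_p1 I22 pN [p1 z + _]addrC.
rewrite -{2}[p2 (p1 z)]scale1r scalerA -scalerDl scalerA sphere_curve_norm // ww.
have p0 : 0 < 1 + t ^+ 2 * (a ^+ 2 + b ^+ 2).
  by rewrite ltr_pwDl // mulr_ge0 ?sqr_ge0 // addr_ge0 ?sqr_ge0.
rewrite exprVn sqr_sqrtr ?ltW // [_ + 1]addrC mulVf ?scale1r // gt_eqF //.
Qed.

(** A vertical Y satisfies [p2 Y = 0], because [p2] is linear and constant along the fibre. Pairing
    [p2 Y] with [dp1 z h], where h is the [horizontal] part of the lift of Y, gives |h|^2, so h
    vanishes. *)
Lemma V_CP3E z Y : S7 z ->
  V_CP3 (p1 z) Y <-> exists a b, Y = dp1 z (a *: I2 z + b *: I3 z).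
Proof.
move=> Sz; split; last first.
  move=> [a [b ->]]; have [zw _] := cperp_vertical z a b.
  have [sm cS c0 dc] := p1_sphere_curve Sz zw.
  eexists; exists 1; split=> // t _; split; first exact: cS.
  exact: p2_p1_fiber.
move=> VY; have /(tangent_space_CP3 _ Sz) [w cw Yw] : tangent_space (@CP3 R) (p1 z) Y.
  by apply: tangent_space_sub VY => Q [].
have pY : p2 Y = 0.
  move: VY => [c [e [e0 sm Mc c0 dc]]].
  have d : differentiable (c : R^o -> CM4) 0 by apply: (sm 1%N).1; exact: ballxx.
  have cp2 := linear_finite_continuous has_coordinates_CM4 p2_linear.
  have := is_diff_comp (differentiableP d) (is_diff_linear (c 0) p2_linear cp2).
  have n1 : {near (0 : R^o), @p2 R \o c =1 cst (p2 (p1 z))}.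
    by apply: filterS (nbhsx_ballx (0 : R^o) e e0) => t /Mc [].
  move=> /(is_diff_near_eq n1) /(is_diff_derive (1 : R^o)); rewrite derive_cst => E.
  by rewrite -dc deriveE //; exact: esym E.
have [a [b [h [hh wE]]]] := cperp_decomposition Sz cw.
exists a, b; rewrite Yw wE; suff -> : h = 0 by rewrite addr0.
apply: g_eq0; have [h0 h1 h2 h3] := hh.
have : fubini_study (dp1 z h) (p2 Y) = g h h.
  rewrite Yw p2_dp1 fubini_studyC fubini_study_Dl !(fubini_studyC _ (dp1 z h)).
  rewrite fubini_study_cperp // wE gDr (gC h (_ + _)) horizontal_vertical // add0r.
  rewrite fubini_study_dp1 -wE !I12 (gC z (I2 z)) !g_I_self (gC h (I2 z)) h2.
  rewrite (_ : g (I1 h) (I2 z) = 0); first by ring.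
  by rewrite g_I1 I12 gC h3 oppr0.
by rewrite pY fubini_study0.
Qed.

Lemma H_CP3E z X : S7 z -> H_CP3 (p1 z) X <-> exists2 h, horizontal z h & X = dp1 z h.
Proof.
move=> Sz; split.
  move=> [/(tangent_space_CP3 _ Sz) [w cw ->]] H; exists w => //.
  have H' a b : g w (a *: I2 z + b *: I3 z) = 0.
    rewrite -(fubini_study_cperp Sz cw (cperp_vertical z a b)); apply: H.
    by apply/V_CP3E => //; exists a, b.
  have [w1 w2] := cw; split=> //.
    by have := H' 1 0; rewrite scale1r scale0r addr0 gC.
  by have := H' 0 1; rewrite scale1r scale0r add0r gC.
move=> [h hh ->]; split.
  by apply/tangent_space_CP3 => //; exists h => //; exact: horizontal_cperp.
move=> Y /(V_CP3E _ Sz) [a [b ->]].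
rewrite fubini_study_cperp //; last exact: cperp_vertical.
  by rewrite gC horizontal_vertical.
exact: horizontal_cperp.
Qed.

Lemma I1_CP3_dp1 z w : S7 z -> cperp z w -> I1_CP3 (p1 z) (dp1 z w) = dp1 z (I1 w).
Proof.
move=> Sz [w1 w2]; rewrite /I1_CP3.
have cD (X Y Z : CM4) : cmulmx (X + Y) Z = cmulmx X Z + cmulmx Y Z.
  by apply: injective_projections; rewrite /= !mulmxDl ?opprD addrACA.
have cDr (X Y Z : CM4) : cmulmx Z (X + Y) = cmulmx Z X + cmulmx Z Y.
  by apply: injective_projections; rewrite /= !mulmxDr ?opprD addrACA.
rewrite /dp1 p1E cD cDr !cmulmx_outer !cscaleE /=.
rewrite (gC w z) w1 w2 Sz g_I_self (g_I1 w) (gC w) w2 oppr0 !scale0r !scale1r !addr0.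
rewrite !mul0mx !subr0 !add0r !addr0.
rewrite !I1E; apply: injective_projections; apply/matrixP => i j.
  by rewrite /= !mxE !big_ord1 !mxE; ring.
by rewrite /= !mxE !big_ord1 !mxE; ring.
Qed.

Lemma horizontal_I1 z h : horizontal z h -> horizontal z (I1 h).
Proof.
move=> [h0 h1 h2 h3].
have s (u v : C4) : g u (I1 v) = - g (I1 u) v by rewrite g_I1 opprK.
by split; rewrite s ?I11 ?I12 ?I13 ?gNl ?h0 ?h1 ?h2 ?h3 ?oppr0.
Qed.

(** The new coefficients come from - I1 (a I2 z + b I3 z) = b I2 z - a I3 z. As the value is
    selected by [xget], the splitting into vertical and horizontal parts must also be shown unique;
    this follows from injectivity of [dp1 z] on [cperp z] and orthonormality of I2 z and I3 z. *)
Lemma I1'_CP3_dp1 z a b h : S7 z -> horizontal z h ->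
  I1'_CP3 (p1 z) (dp1 z (a *: I2 z + b *: I3 z + h)) =
  dp1 z (b *: I2 z + (- a) *: I3 z + I1 h).
Proof.
move=> Sz hh.
have E a' b' h' : horizontal z h' ->
    - I1_CP3 (p1 z) (dp1 z (a' *: I2 z + b' *: I3 z)) + I1_CP3 (p1 z) (dp1 z h') =
    dp1 z (b' *: I2 z + (- a') *: I3 z + I1 h').
  move=> hh'; rewrite !I1_CP3_dp1 //; [|exact: horizontal_cperp|exact: cperp_vertical].
  rewrite [in RHS]dp1Dr -dp1Nr; congr (dp1 z _ + _).
  by rewrite I_D !I_Z I12 I13 scalerN opprD opprK scaleNr addrC.
apply: xget_subset1.
  exists (dp1 z (a *: I2 z + b *: I3 z)), (dp1 z h); split.
  - by apply/V_CP3E => //; exists a, b.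
  - by apply/H_CP3E => //; exists h.
  - by rewrite dp1Dr.
  - by rewrite E.
suff U Y : (exists Xv Xh, [/\ V_CP3 (p1 z) Xv, H_CP3 (p1 z) Xh,
    dp1 z (a *: I2 z + b *: I3 z + h) = Xv + Xh &
    Y = - I1_CP3 (p1 z) Xv + I1_CP3 (p1 z) Xh]) ->
    Y = dp1 z (b *: I2 z + (- a) *: I3 z + I1 h).
  by move=> Y1 Y2 /U -> /U ->.
move=> [Xv [Xh [/(V_CP3E _ Sz) [a' [b' ->]] /(H_CP3E _ Sz) [h' hh' ->] EX ->]]].
rewrite (E a' b' h' hh').
have cp a0 b0 h0 : horizontal z h0 -> cperp z (a0 *: I2 z + b0 *: I3 z + h0).
  move=> [k0 k1 _ _]; have [v0 v1] := cperp_vertical z a0 b0.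
  by split; rewrite gDr ?v0 ?v1 ?k0 ?k1 addr0.
have EW : a *: I2 z + b *: I3 z + h = a' *: I2 z + b' *: I3 z + h'.
  by apply: (dp1_inj Sz); [exact: cp|exact: cp|rewrite EX -dp1Dr].
have c2 a0 b0 h0 : horizontal z h0 -> g (I2 z) (a0 *: I2 z + b0 *: I3 z + h0) = a0.
  by move=> [_ _ k2 _]; rewrite !gDr !gZr k2 g_I2_I2 g_I2_I3 Sz mulr1 mulr0 !addr0.
have c3 a0 b0 h0 : horizontal z h0 -> g (I3 z) (a0 *: I2 z + b0 *: I3 z + h0) = b0.
  by move=> [_ _ _ k3]; rewrite !gDr !gZr k3 g_I3_I3 (gC (I3 z) (I2 z)) g_I2_I3 Sz mulr1 mulr0
    addr0 add0r.
have ea : a = a' by rewrite -(c2 a b h) // EW c2.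
have eb : b = b' by rewrite -(c3 a b h) // EW c3.
by move: EW; rewrite ea eb => /addrI ->.
Qed.

End TangentProjectiveSpace.

(** * The squashed structure *)

Section SquashedForm.
Context {R : realType}.
Local Notation C4 := (C4 R).
Local Notation g := (@g R).
Local Notation eta := (@Defs.eta R).
Local Notation I1 := (@I_ R 0).
Local Notation I2 := (@I_ R 1).
Local Notation I3 := (@I_ R 2%:R).

Lemma sum_ord3 (V : nmodType) (F : 'I_3 -> V) : \sum_i F i = F 0 + F 1 + F 2%:R.
Proof.
rewrite !big_ord_recl big_ord0 addr0 addrA.
by congr (F _ + F _ + F _); apply: val_inj.
Qed.

Lemma det2 (M : 'M[R]_2) : \det M = M 0 0 * M 1 1 - M 0 1 * M 1 0.
Proof.
rewrite (expand_det_row _ 0) !big_ord_recl big_ord0 addr0 /cofactor !det_mx11 !mxE /=.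
have E (i j : 'I_2) : val i = val j -> i = j by exact: val_inj.
rewrite (E (lift 0 0) 1) // (E (lift 1 0) 0) //= expr0 expr1; ring.
Qed.

Lemma det3 (M : 'M[R]_3) : \det M =
  M 0 0 * (M 1 1 * M 2%:R 2%:R - M 1 2%:R * M 2%:R 1)
  - M 0 1 * (M 1 0 * M 2%:R 2%:R - M 1 2%:R * M 2%:R 0)
  + M 0 2%:R * (M 1 0 * M 2%:R 1 - M 1 1 * M 2%:R 0).
Proof.
rewrite (expand_det_row _ 0) sum_ord3 /cofactor !det2 !mxE /=.
have L0 (i j : 'I_3) (k : 'I_2) : val (lift i k) = val j -> lift i k = j by move=> ?;
  exact: val_inj.
rewrite (L0 0 1 0) // (L0 0 2%:R 1) // (L0 1 0 0) // (L0 1 2%:R 1) // (L0 2%:R 0 0) //.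
rewrite (L0 2%:R 1 1) // /bump /= addn0 !expr0 !expr1 sqrrN expr1n; ring.
Qed.

Lemma eta_linear i z : linear (eta i z : C4 -> R^o).
Proof. exact: g_linear. Qed.

(** [eta i] is linear in the base point, so its derivative in direction k is its value at k; the two
    terms of the exterior derivative then agree by skewness of [I_ i]. *)
Lemma ext_deriv1_eta i (z u v : C4) : ext_deriv1 (eta i) z u v = - 2 * g (I_ i u) v.
Proof.
have D (w k : C4) : 'D_k (fun y => eta i y w) z = - g (I_ i k) w.
  have l : linear (fun y => eta i y w : R^o).
    move=> a x y; rewrite /eta /xi I_D I_Z opprD gDl -scalerN gZl //.
  have c := linear_finite_continuous has_coordinates_C4 l.
  by rewrite (is_diff_derive k (is_diff_linear z l c)) /eta /xi gNl.
rewrite /ext_deriv1 !D (g_I i v) (gC v); ring.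
Qed.

Lemma omegaE i (z u v : C4) : omega i z u v = - g (I_ i (hproj z u)) (hproj z v).
Proof. by rewrite /omega ext_deriv1_eta; field. Qed.

Lemma vprojE (z v : C4) : vproj z v = eta 0 z v *: xi 0 z + eta 1 z v *:
  xi 1 z + eta 2%:R z v *: xi 2%:R z.
Proof. by rewrite /vproj sum_ord3. Qed.

Lemma hproj_linear (z : C4) : linear (hproj z).
Proof.
move=> a u v; rewrite /hproj /vproj scalerBr addrACA -opprD; congr (_ - _).
rewrite scaler_sumr -big_split; apply: eq_bigr => i _.
by rewrite /= eta_linear scalerDl scalerA.
Qed.

Lemma omega_linearl i (z v : C4) : linear (fun u => omega i z u v : R^o).
Proof. by move=> a u w; rewrite !omegaE hproj_linear I_D I_Z gDl gZl opprD /GRing.scale /=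
  mulrN. Qed.

Lemma omegaN i (z u v : C4) : omega i z u v = - omega i z v u.
Proof. by rewrite !omegaE g_I; congr (- - _); rewrite gC. Qed.

Lemma wedge12_mul (alpha : C4 -> R) (beta : C4 -> C4 -> R) (A : 'M[R]_3) (e : 'I_3 -> C4) :
  linear (alpha : C4 -> R^o) -> (forall v, linear (fun u => beta u v : R^o)) ->
  (forall u v, beta u v = - beta v u) ->
  wedge12 alpha beta (fun i => \sum_j A i j *: e j) = \det A * wedge12 alpha beta e.
Proof.
move=> la lb sb.
have aS i : alpha (\sum_j A i j *: e j) = A i 0 * alpha (e 0) + A i 1 * alpha (e 1) +
  A i 2%:R * alpha (e 2%:R).
  by rewrite (linear_sumE _ _ la) sum_ord3.
have bSl i v : beta (\sum_j A i j *: e j) v = A i 0 * beta (e 0) v + A i 1 * beta (e 1) v +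
  A i 2%:R * beta (e 2%:R) v.
  by rewrite (linear_sumE _ _ (lb v)) sum_ord3.
have bSr i u : beta u (\sum_j A i j *: e j) = A i 0 * beta u (e 0) + A i 1 * beta u (e 1) +
  A i 2%:R * beta u (e 2%:R).
  by rewrite sb bSl !(sb u); ring.
have b0 u : beta u u = 0.
  by have /eqP := sb u u; rewrite -addr_eq0 -mulr2n mulrn_eq0 /= => /eqP.
rewrite /wedge12 !aS !bSl !bSr !b0 (sb (e 1) (e 0)) (sb (e 2%:R) (e 0)) (sb (e 2%:R) (e 1)) det3.
ring.
Qed.

(** The form is alternating and trilinear. All orientation arguments below rest on this: signs of
    the form are compared through signs of determinants. *)
Lemma squashed_form_mul (z : C4) (A : 'M[R]_3) (e e' : 'I_3 -> C4) :
  (forall i, e' i = \sum_j A i j *: e j) ->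
  squashed_form z e' = \det A * squashed_form z e.
Proof.
move=> /funext ->; rewrite /squashed_form.
have -> : \matrix_(i, j) eta i z (\sum_k A j k *: e k) = (\matrix_(i, j) eta i z (e j)) *m A^T.
  apply/matrixP => i j; rewrite !mxE (linear_sumE _ _ (@eta_linear i z)).
  by apply: eq_bigr => k _; rewrite !mxE mulrC.
rewrite det_mulmx det_tr.
have E i : wedge12 (eta i z) (omega i z) (fun i0 => \sum_j A i0 j *: e j) =
    \det A * wedge12 (eta i z) (omega i z) e.
  apply: wedge12_mul.
  - exact: eta_linear.
  - exact: omega_linearl.
  - exact: omegaN.
set d := \det (\matrix_(i, j) _); set D := \det A in E *.
transitivity (27 / 25 * (1 / 5 * (d * D) + D * \sum_i wedge12 (eta i z) (omega i z) e));
  last by ring.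
congr (_ * (_ + _)); rewrite [RHS]mulr_sumr; apply: eq_bigr => i _; exact: E.
Qed.

(** Normal form of a tangent vector of [S7] at z, from which [eta], [vproj] and [hproj] are read off
    when h is [horizontal]. *)
Definition qvec (z : C4) (c a b : R) (h : C4) : C4 := c *: I1 z + (a *: I2 z + b *: I3 z + h).

Lemma eta_qvec z c a b h : S7 z -> horizontal z h ->
  [/\ eta 0 z (qvec z c a b h) = - c, eta 1 z (qvec z c a b h) = - a &
      eta 2%:R z (qvec z c a b h) = - b].
Proof.
move=> Sz [h0 h1 h2 h3].
have z12 : g (I1 z) (I2 z) = 0 by rewrite g_I1 I12 gC g_I_self oppr0.
have z13 : g (I1 z) (I3 z) = 0 by rewrite g_I1 I13 gNr gC g_I_self !oppr0.
rewrite /eta /xi /qvec !gNl !gDr !gZr h1 h2 h3 g_I1I1 g_I2_I2 g_I3_I3.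
by rewrite (gC (I3 z) (I2 z)) (gC (I3 z) (I1 z)) (gC (I2 z) (I1 z)) g_I2_I3 z12 z13 Sz; split;
  ring.
Qed.

Lemma vproj_qvec z c a b h : S7 z -> horizontal z h ->
  vproj z (qvec z c a b h) = c *: I1 z + (a *: I2 z + b *: I3 z).
Proof.
move=> Sz hh; have [e0 e1 e2] := eta_qvec c a b Sz hh.
by rewrite vprojE e0 e1 e2 /xi !scalerN !scaleNr !opprK addrA.
Qed.

Lemma hproj_qvec z c a b h : S7 z -> horizontal z h -> hproj z (qvec z c a b h) = h.
Proof.
by move=> Sz hh; rewrite /hproj vproj_qvec // /qvec !addrA [X in X - _]addrC addrK.
Qed.

Lemma squashed_metric_qvec z c a b h c' a' b' h' : S7 z -> horizontal z h -> horizontal z h' ->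
  squashed_metric z (qvec z c a b h) (qvec z c' a' b' h') =
  9 / 25 * (c * c' + a * a' + b * b') + 9 / 5 * g h h'.
Proof.
move=> Sz hh hh'; rewrite /squashed_metric !vproj_qvec // !hproj_qvec //.
have -> : (3 / Num.sqrt 5) ^+ 2 = 9 / 5 :> R.
  by rewrite expr_div_n sqr_sqrtr //; field.
have z12 : g (I1 z) (I2 z) = 0 by rewrite g_I1 I12 gC g_I_self oppr0.
have z13 : g (I1 z) (I3 z) = 0 by rewrite g_I1 I13 gNr gC g_I_self !oppr0.
congr (_ + _); rewrite !gDl !gDr !gZl !gZr g_I1I1 g_I2_I2 g_I3_I3.
rewrite (gC (I3 z) (I2 z)) (gC (I3 z) (I1 z)) (gC (I2 z) (I1 z)) g_I2_I3 z12 z13 Sz.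
by field.
Qed.

Lemma horizontalZ (z : C4) a h : horizontal z h -> horizontal z (a *: h).
Proof. by move=> [h0 h1 h2 h3]; split; rewrite gZr ?h0 ?h1 ?h2 ?h3 mulr0. Qed.

Lemma horizontal0 (z : C4) : horizontal z 0.
Proof. by split; rewrite g0r. Qed.

Definition frame3 (V : Type) (x y t : V) (i : 'I_3) : V :=
  match val i with 0 => x | 1 => y | _ => t end.

(* Here w' is the image of w under I1'. The form and the squared norm
   N = 9/25 (a^2 + b^2) + 9/5 |h|^2 of w match because of the squashing factors. *)
Lemma adapted_frame z a b h (w := a *: I2 z + b *: I3 z + h)
    (w' := b *: I2 z + (- a) *: I3 z + I1 h) : S7 z -> horizontal z h -> w != 0 ->
  exists s : R, let f := frame3 ((5 / 3) *: I1 z) (s *: w) (s *: w') in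
  [/\ s != 0, forall i j, squashed_metric z (f i) (f j) = (i == j)%:R &
      squashed_form z f = 1].
Proof.
move=> Sz hh w0.
pose N := 9 / 25 * (a * a + b * b) + 9 / 5 * g h h.
have hp := g_ge0 h.
have N0 : 0 < N.
  have : 0 <= N by rewrite /N; nra.
  rewrite le_eqVlt => /orP[/eqP NE|//].
  have gh : g h h = 0 by move: NE; rewrite /N; nra.
  have a0 : a = 0 by apply/eqP; rewrite -sqrf_eq0; apply/eqP; move: NE; rewrite /N gh; nra.
  have b0 : b = 0 by apply/eqP; rewrite -sqrf_eq0; apply/eqP; move: NE; rewrite /N gh; nra.
  by move: w0; rewrite /w a0 b0 !scale0r !add0r (g_eq0 gh) eqxx.
pose s := (Num.sqrt N)^-1.
have sN : s * s * N = 1 by rewrite -expr2 exprVn sqr_sqrtr ?ltW // mulVf // gt_eqF.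
exists s => f.
have s0 : s != 0 by rewrite invr_eq0 gt_eqF // sqrtr_gt0.
have f0 : f 0 = qvec z (5 / 3) 0 0 0 by rewrite /f /frame3 /= /qvec !scale0r !addr0.
have f1 : f 1 = qvec z 0 (s * a) (s * b) (s *: h).
  by rewrite /f /frame3 /= /qvec /w scale0r add0r !scalerDr !scalerA.
have f2 : f 2%:R = qvec z 0 (s * b) (- (s * a)) (s *: I1 h).
  by rewrite /f /frame3 /= /qvec /w' scale0r add0r !scalerDr !scalerA mulrN.
have h1 := horizontal0 z.
have h2 := horizontalZ s hh.
have h3 := horizontalZ s (horizontal_I1 hh).
have F (P : 'I_3 -> Prop) : P 0 -> P 1 -> P 2%:R -> forall i, P i.
  move=> p0 p1 p2 [[|[|[|//]]] Hi].
  - by rewrite (_ : Ordinal Hi = 0) //; apply: val_inj.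
  - by rewrite (_ : Ordinal Hi = 1) //; apply: val_inj.
  - by rewrite (_ : Ordinal Hi = 2%:R) //; apply: val_inj.
have ghI : g h (I1 h) = 0 by rewrite gC g_I_self.
have sNe : 9 / 25 * (s * a * (s * a) + s * b * (s * b)) + 9 / 5 * (s * (s * g h h)) = 1.
  by rewrite -[RHS]sN /N; ring.
split=> //.
  apply: (F _); apply: (F _); rewrite ?f0 ?f1 ?f2 squashed_metric_qvec //= ?g0l ?g0r ?gZl ?gZr
    ?g_I1I1 ?ghI ?g_I_self //.
  1-9: try by field.
  1,2: rewrite -[RHS]sNe; ring.
(* The first frame vector is I1 z divided by its squashed length 3/5; its [eta] values are -5/3, 0,
   0 and it has no horizontal part, so only the determinant and the term of [eta 0] and [omega 0]
   survive. Since 27/125 times 5/3 is 9/25 and 27/25 times 5/3 is 9/5, they add up to s^2 N = 1. *)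
rewrite /squashed_form det3 sum_ord3 /wedge12 !omegaE !mxE f0 f1 f2 !hproj_qvec //.
have [-> -> ->] := eta_qvec (5 / 3) 0 0 Sz h1.
have [-> -> ->] := eta_qvec 0 (s * a) (s * b) Sz h2.
have [-> -> ->] := eta_qvec 0 (s * b) (- (s * a)) Sz h3.
have I0 i : I_ i (0 : C4) = 0 by have := I_Z i 0 (0 : C4); rewrite !scale0r.
rewrite !I0 !g0l !I_Z !gZl !gZr g_I1I1 -[RHS]sNe.
by field.
Qed.

End SquashedForm.

(** * The Hopf lift *)

Section HopfLiftChart.
Context {R : realType}.
Local Notation C4 := (C4 R).
Local Notation CM4 := (CM4 R).
Local Notation g := (@g R).
Local Notation I1 := (@I_ R 0).

Lemma local_parametrization_restrict (V : normedModType R) k (M : set V)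
    (U U' : set 'rV[R]_k) psi :
  local_parametrization M U psi -> open U' -> U' `<=` U -> local_parametrization M U' psi.
Proof.
move=> [oU sm inj injd opn] oU' sU; split=> //.
- by move=> n; exact: Cn_on_sub sU (sm n).
- by move=> x y /sU Ux /sU Uy; exact: inj.
- by move=> x /sU; exact: injd.
- by move=> W oW sW; apply: opn => //; exact: subset_trans sU.
Qed.

Lemma open_positive (V : normedModType R) (U : set V) (f : V -> R) :
  open U -> (forall x, U x -> {for x, continuous (f : V -> R^o)}) ->
  open [set x | U x /\ 0 < f x].
Proof.
move=> oU cf; rewrite openE => x [Ux fx] /=.
have n1 : \forall y \near x, U y by exact: open_nbhs_nbhs.
have n2 : \forall y \near x, 0 < f y by have /cvgr_gt := cf x Ux; apply.
by near=> y; split; near: y.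
Unshelve. all: by end_near. Qed.

(* Multiplication by the unit complex number (1 + i m) / |1 + i m|. *)
Definition phase (m : R) (u : C4) : C4 := (Num.sqrt (1 + m * m))^-1 *: (1 *: u + m *: I1 u).

(** R^3 is cut into R^2, where the chart of Sigma lives, and R for the Hopf circle; the explicit
    arguments make 3 be read as 2 + 1. *)
Definition base_coord (y : 'rV[R]_3) : 'rV[R]_2 := @lsubmx R 1 2 1 y.
Definition fiber_coord (y : 'rV[R]_3) : R := y 0 2%:R.
Definition join_coord (x : 'rV[R]_2) (t : R) : 'rV[R]_3 := @row_mx R 1 2 1 x t%:M.

Lemma base_coord_join x t : base_coord (join_coord x t) = x.
Proof. exact: row_mxKl. Qed.
Lemma ord2_rshift : 2%:R = rshift 2 (0 : 'I_1) :> 'I_3.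
Proof. exact: val_inj. Qed.
Lemma fiber_coord_join x t : fiber_coord (join_coord x t) = t.
Proof.
rewrite /fiber_coord ord2_rshift; transitivity ((t%:M : 'M[R]_1) 0 0); last by rewrite mxE eqxx.
exact: (row_mxEr x t%:M 0 0).
Qed.
Lemma coordK y : join_coord (base_coord y) (fiber_coord y) = y.
Proof.
rewrite /join_coord (_ : (fiber_coord y)%:M = @rsubmx R 1 2 1 y);
  first exact: (@hsubmxK R 1 2 1 y).
by apply/matrixP => i j; rewrite !ord1 !mxE eqxx /fiber_coord ord2_rshift.
Qed.
Lemma base_coord_linear : linear base_coord.
Proof. by move=> a u v; rewrite /base_coord linearP. Qed.
Lemma fiber_coord_linear : linear (fiber_coord : _ -> R^o).
Proof. by move=> a u v; rewrite /fiber_coord !mxE. Qed.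
Lemma base_coord_continuous : continuous base_coord.
Proof. exact: (linear_finite_continuous (has_coordinates_mx _ _) base_coord_linear). Qed.
Lemma fiber_coord_continuous : continuous (fiber_coord : _ -> R^o).
Proof. exact: (linear_finite_continuous (has_coordinates_mx _ _) fiber_coord_linear). Qed.

Context (Sigma : set CM4) (z0 : C4) (s : R) (U0 : set 'rV[R]_2) (psi : 'rV[R]_2 -> CM4)
  (sub_CP3 : Sigma `<=` @CP3 R) (s_neq0 : s != 0)
  (psi_chart : local_parametrization Sigma U0 psi).

(* The sign of s decides the orientation of the chart. *)
Definition hopf_chart (y : 'rV[R]_3) : C4 :=
  phase (s * fiber_coord y) (hopf_section z0 (psi (base_coord y))).

Definition hopf_domain : set 'rV[R]_3 :=
  [set y | U0 (base_coord y) /\ 0 < g z0 (cmulv (psi (base_coord y)) z0)].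

Lemma hopf_domain_open : open hopf_domain.
Proof.
have [oU sm _ _ _] := psi_chart.
have lq : linear (fun Q => g z0 (cmulv Q z0) : R^o).
  by move=> a P Q; rewrite (cmulv_linear z0) g_linear.
have o1 : open [set x | U0 x /\ 0 < g z0 (cmulv (psi x) z0)].
  apply: open_positive => // x Ux.
  apply: (@continuous_comp _ _ _ psi (fun Q => g z0 (cmulv Q z0) : R^o)).
    exact: (sm 0%N).
  exact: (linear_finite_continuous has_coordinates_CM4 lq).
by apply: (open_comp _ o1) => y _; exact: base_coord_continuous.
Qed.

Lemma S7E (z : C4) : S7 z = (g z z = 1).
Proof. by []. Qed.

Lemma one_add_sqr_gt0 (m : R) : 0 < 1 + m * m.
Proof. by rewrite ltr_pwDl // -expr2 sqr_ge0. Qed.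

Lemma hopf_chart_smooth : smooth_on hopf_domain hopf_chart.
Proof.
move=> n; have oD := hopf_domain_open; have [oU sm _ _ _] := psi_chart.
have Hb : Cn_on n hopf_domain (fun y => psi (base_coord y)).
  have := Cn_on_comp_affine 0 base_coord_linear base_coord_continuous oU (sm n).
  under [X in Cn_on _ _ X]eq_fun do rewrite addr0.
  by apply: Cn_on_sub => y [] /=; rewrite addr0.
have Hu : Cn_on n hopf_domain (fun y => hopf_section z0 (psi (base_coord y))).
  by apply: Cn_on_hopf_section => // y [].
have Hm : Cn_on n hopf_domain (fun y => s * fiber_coord y).
  apply: Cn_on_mul => //; first exact: Cn_on_cst.
  have := Cn_on_affine n hopf_domain 0 fiber_coord_linear fiber_coord_continuous.
  by apply: Cn_on_ext => // y _; exact: addr0.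
apply: Cn_on_scale => //.
  apply: Cn_on_rsqrt => //; first by move=> y _; exact: one_add_sqr_gt0.
  by apply: Cn_on_add => //; [exact: Cn_on_cst | exact: Cn_on_mul].
apply: Cn_on_add => //.
  by apply: Cn_on_scale => //; exact: Cn_on_cst.
apply: Cn_on_scale => //; apply: Cn_on_linear => //; first exact: I_linear.
exact: (linear_finite_continuous has_coordinates_C4 (@I_linear R 0)).
Qed.

(** The section u is chosen with z0^* u real and positive, and the phase multiplies this number by a
    positive multiple of 1 + i m, where m is s times the fibre coordinate. Hence m is recovered as
    the ratio of the imaginary to the real part of the Hermitian product with z0. *)
Lemma hopf_chartP y : hopf_domain y ->
  [/\ S7 (hopf_chart y), p1 (hopf_chart y) = psi (base_coord y), 0 < g z0 (hopf_chart y) &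
      g (I1 z0) (hopf_chart y) = s * fiber_coord y * g z0 (hopf_chart y)].
Proof.
move=> [Uy qy]; have cQ := sub_CP3 (local_parametrization_sub psi_chart Uy).
have [Su pu] := hopf_sectionP cQ qy.
rewrite /hopf_chart /phase; set m := s * _; set u := hopf_section _ _ in Su pu *.
have m0 := one_add_sqr_gt0 m.
set rho := (Num.sqrt _)^-1.
have rho0 : 0 < rho by rewrite invr_gt0 sqrtr_gt0.
have rho2 : rho ^+ 2 * (1 + m * m) = 1 by rewrite exprVn sqr_sqrtr ?ltW // mulVf // gt_eqF.
have uE : u = (Num.sqrt (g z0 (cmulv (psi (base_coord y)) z0)))^-1 *:
  cmulv (psi (base_coord y)) z0 by [].
clearbody u.
have g0u : 0 < g z0 u by rewrite uE gZr mulr_gt0 // invr_gt0 sqrtr_gt0.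
have g1u : g (I1 z0) u = 0.
  rewrite uE gZr (_ : g (I1 z0) _ = 0) ?mulr0 //; have [v _ <-] := cQ.
  rewrite cmulv_p1 gDr !gZr g_I1I1 (g_I1 z0 v) (gC z0 (I1 v)) (gC z0 v); ring.
have z1u : g z0 (I1 u) = 0 by rewrite gC g_I1 gC g1u oppr0.
split.
- rewrite S7E !gZl gZr !gDl !gDr !gZl !gZr g_I1I1 (gC u (I1 u)) g_I_self Su.
  by rewrite -[RHS]rho2; ring.
- by rewrite p1Z p1_combination pu scalerA expr1n [m ^+ 2]expr2 rho2 scale1r.
- rewrite gZr gDr !gZr z1u mulr0 addr0 mul1r.
  exact: mulr_gt0.
- by rewrite !gZr !gDr !gZr z1u g_I1I1 g1u; ring.
Qed.

Lemma hopf_chart_lift y : hopf_domain y -> Hopf_lift Sigma (hopf_chart y).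
Proof.
move=> Dy; have [S p _ _] := hopf_chartP Dy; split=> //.
by rewrite /preimage /= p; apply: (local_parametrization_sub psi_chart); case: Dy.
Qed.

(** Explicit inverse of the chart. As psi x = z z^*, the section is a positive multiple of (al - i
    be) z, which the phase of slope be / al turns into a positive multiple of z; both are unit
    vectors, so they agree. *)
Lemma hopf_chart_surj z x : S7 z -> p1 z = psi x -> U0 x -> 0 < g z0 z ->
  let y := join_coord x (s^-1 * (g (I1 z0) z / g z0 z)) in
  hopf_domain y /\ hopf_chart y = z.
Proof.
move=> Sz pz Ux a0 y.
set al := g z0 z in a0 y *; set be := g (I1 z0) z in y *.
have zE : cmulv (psi x) z0 = al *: z - be *: I1 z.
  rewrite -pz cmulv_p1 (gC z z0); congr (_ + _); rewrite -scaleNr; congr (_ *: _).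
  by rewrite /be (g_I1 z) gC.
have q0 : 0 < g z0 (cmulv (psi x) z0).
  by rewrite -pz g_cmulv_p1 (gC z) ltr_pwDl ?sqr_ge0 // exprn_gt0.
have Dy : hopf_domain y by rewrite /hopf_domain /= base_coord_join.
split=> //.
have [S _ _ _] := hopf_chartP Dy.
pose m := be / al.
have mE : s * fiber_coord y = m by rewrite fiber_coord_join mulrA mulfV // mul1r.
pose r := (Num.sqrt (g z0 (cmulv (psi x) z0)))^-1.
pose k := (Num.sqrt (1 + m * m))^-1 * r * (al + m * be).
have kE : hopf_chart y = k *: z.
  rewrite /hopf_chart /phase mE base_coord_join /hopf_section -/r zE /k scale1r.
  have mal : m * al = be by rewrite mulfVK // gt_eqF.
  have -> : I1 (r *: (al *: z - be *: I1 z)) = r *: (al *: I1 z + be *: z).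
    by rewrite I_Z I_D I_N !I_Z I11 scalerN opprK.
  move: (I1 z) => Q; rewrite -mulrA -[RHS]scalerA; congr (_ *: _).
  rewrite [m *: _]scalerA [m * r]mulrC -[_ *: (al *: Q + _)]scalerA -scalerDr -[RHS]scalerA.
  by congr (_ *: _); rewrite scalerDr !scalerA mal scalerDl addrA subrK.
have k0 : 0 < k.
  rewrite !mulr_gt0 // ?invr_gt0 ?sqrtr_gt0 ?one_add_sqr_gt0 //.
  by rewrite /m ltr_pwDl // mulrAC -expr2 mulr_ge0 ?sqr_ge0 // invr_ge0 ltW.
move: S; rewrite kE S7E gZl gZr Sz mulr1 -expr2 => /eqP.
by rewrite sqrf_eq1 => /orP[/eqP -> | /eqP kN]; [rewrite scale1r | move: k0;
  rewrite kN oppr_gt0 ltr10].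
Qed.

Lemma hopf_chart_inj y y' : hopf_domain y -> hopf_domain y' ->
  hopf_chart y = hopf_chart y' -> y = y'.
Proof.
move=> Dy Dy' E; have [_ _ inj _ _] := psi_chart.
have [_ p a b] := hopf_chartP Dy; have [_ p' a' b'] := hopf_chartP Dy'.
rewrite -(coordK y) -(coordK y'); congr join_coord.
  by apply: inj; [case: Dy | case: Dy' | rewrite -p -p' E].
rewrite -E in b'.
have H := mulIf (lt0r_neq0 a) (etrans (esym b) b').
exact: (mulfI s_neq0 H).
Qed.

(* If d hopf_chart kills k, then differentiating p1 o hopf_chart = psi o base_coord
   kills the base part of k, and differentiating the last clause of [hopf_chartP]
   kills the fibre part. *)
Lemma hopf_chart_diff_inj y : hopf_domain y -> injective ('d hopf_chart y).
Proof.
move=> Dy; have [oU sm _ injd _] := psi_chart.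
have [_ _ a _] := hopf_chartP Dy.
have oD := hopf_domain_open.
have d : differentiable hopf_chart y by exact: (hopf_chart_smooth 1%N).1.
suff H k : 'd hopf_chart y k = 0 -> k = 0.
  move=> k k' E; apply/eqP; rewrite -subr_eq0; apply/eqP/H.
  by rewrite linearB /= E subrr.
move=> k0.
have dpsi : differentiable psi (base_coord y) by apply: (sm 1%N).1; case: Dy.
have n1 : {near y, (fun x => p1 (hopf_chart x)) =1 psi \o base_coord}.
  by apply: (open_near_eq oD Dy) => x /hopf_chartP [].
have d1 := is_diff_near_eq n1 (is_diff_p1 (differentiableP d)).
have d2 := is_diff_comp (is_diff_linear y base_coord_linear (@base_coord_continuous))
  (differentiableP dpsi).
have b0 : base_coord k = 0.
  apply: (injd (base_coord y)); first by case: Dy.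
  have := is_diff_derive k d2; rewrite (is_diff_derive k d1) k0 linear0 /= => <-.
  by rewrite dp1r0.
have lin (c : C4) : is_diff y (fun x => g c (hopf_chart x)) (fun h => g c ('d hopf_chart y h)).
  have := is_diff_g (is_diff_cst c y) (differentiableP d).
  by under [X in is_diff_def _ _ X -> _]eq_fun do rewrite g0l add0r.
have df : is_diff y (fun x => s * fiber_coord x) (fun x => s * fiber_coord x).
  have l : linear (fun x => s * fiber_coord x : R^o).
    by move=> c u v; rewrite /= fiber_coord_linear /GRing.scale /=; ring.
  exact: (is_diff_linear y l (linear_finite_continuous (has_coordinates_mx _ _) l)).
have n2 : {near y, (fun x => g (I1 z0) (hopf_chart x)) =1
    (fun x => s * fiber_coord x) * (fun x => g z0 (hopf_chart x))}.
  by apply: (open_near_eq oD Dy) => x /hopf_chartP [].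
have := is_diff_derive k (is_diff_near_eq n2 (lin (I1 z0))).
rewrite (is_diff_derive k (is_diffM df (lin z0))) k0 g0r.
rewrite -[X in X = _]/(s * fiber_coord y * g z0 ('d hopf_chart y k) +
   g z0 (hopf_chart y) * (s * fiber_coord k)) k0 g0r mulr0 add0r => /eqP.
rewrite !mulf_eq0 gt_eqF //= (negPf s_neq0) /= => /eqP t0.
rewrite -(coordK k) b0 t0 /join_coord.
apply/matrixP => i j; rewrite mxE; case: fintype.splitP => l _; rewrite !mxE //.
by rewrite mul0rn.
Qed.

Lemma hopf_chart_open W : open W -> W `<=` hopf_domain ->
  exists2 O : set C4, open O & hopf_chart @` W = Hopf_lift Sigma `&` O.
Proof.
move=> oW sW; have [oU sm inj injd opn] := psi_chart.
(* The largest candidate for O: what remains is that near each image point every point of the lift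
   belongs to the image. *)
exists (interior [set z | Hopf_lift Sigma z -> (hopf_chart @` W) z]); first exact: open_interior.
apply/seteqP; split=> z; last first.
  by move=> [Az /interior_subset]; apply.
move=> [y Wy <-] {z}; have Dy := sW y Wy; split; first exact: hopf_chart_lift.
have [Sy py ay by_] := hopf_chartP Dy.
set zy := hopf_chart y in Sy py ay by_ *.
have /nbhs_ballP [e /= e0 He] : nbhs y W by exact: open_nbhs_nbhs.
have cg (c : C4) : continuous (g c : C4 -> R^o).
  exact: (linear_finite_continuous has_coordinates_C4 (@g_linear R c)).
pose U1 := U0 `&` ball (base_coord y) e.
have [N oN EN] := opn U1 (openI oU (ball_open _ e)) (@subIsetl _ _ _).
have cp : {for zy, continuous (@p1 R)}.
  by apply: differentiable_continuous; case: (is_diff_p1 (is_diff_id zy)).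
have nN : \forall z \near zy, N (p1 z).
  apply: cp; apply: open_nbhs_nbhs; split=> //.
  have [] // : (Sigma `&` N) (p1 zy).
  by rewrite -EN py; exists (base_coord y) => //; split; [case: Dy | exact: ballxx].
have na : \forall z \near zy, 0 < g z0 z by have /cvgr_gt := @cg z0 zy; apply.
have ct : {for zy, continuous (fun z => s^-1 * (g (I1 z0) z / g z0 z) : R^o)}.
  have cV : {for zy, continuous (fun z => (g z0 z)^-1 : R^o)}.
    by apply: (@continuousV R C4 (g z0 : C4 -> R)); [exact: lt0r_neq0 | exact: cg].
  have c2 := @continuousM R C4 (g (I1 z0) : C4 -> R) (fun z => (g z0 z)^-1) zy (cg _ _) cV.
  have c1 : {for zy, continuous (fun _ : C4 => s^-1 : R^o)} by exact: cvg_cst.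
  by have := @continuousM R C4 _ _ zy c1 c2.
have tE : s^-1 * (g (I1 z0) zy / g z0 zy) = fiber_coord y.
  by rewrite by_ mulfK ?gt_eqF // mulrA mulVf // mul1r.
have nt : \forall z \near zy, ball (fiber_coord y) e (s^-1 * (g (I1 z0) z / g z0 z)).
  by move: ct; rewrite /prop_for /continuous_at tE; apply; exact: nbhsx_ballx.
(* The chart coordinates of a nearby point of the lift are close to y: the base part because psi is
   open onto Sigma, the fibre part because the ratio defining it is continuous. *)
near=> z => /= -[Sz Pz].
have [x [Ux Bx] Ex] : (psi @` U1) (p1 z) by rewrite EN; split=> //; near: z.
have a : 0 < g z0 z by near: z.
have [Dx Cx] := hopf_chart_surj Sz (esym Ex) Ux a.
exists (join_coord x (s^-1 * (g (I1 z0) z / g z0 z))) => //; apply: He.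
have Bt : ball (fiber_coord y) e (s^-1 * (g (I1 z0) z / g z0 z)) by near: z.
move: Bt; set t := s^-1 * _ => Bt.
split=> // i j; rewrite -(coordK y) /join_coord.
move: Bx => [_ Bx].
rewrite !mxE; case: fintype.splitP => l _.
  exact: Bx.
by rewrite !ord1 !mxE eqxx.
Unshelve. all: by end_near. Qed.

Lemma hopf_chart_parametrization :
  local_parametrization (Hopf_lift Sigma) hopf_domain hopf_chart.
Proof.
split.
- exact: hopf_domain_open.
- exact: hopf_chart_smooth.
- exact: hopf_chart_inj.
- exact: hopf_chart_diff_inj.
- exact: hopf_chart_open.
Qed.

End HopfLiftChart.

(** * Tangent frames, orientation and associativity of the lift *)

Section HopfLift.
Context {R : realType}.
Local Notation C4 := (C4 R).
Local Notation CM4 := (CM4 R).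
Local Notation g := (@g R).
Local Notation eta := (@Defs.eta R).
Local Notation I1 := (@I_ R 0).
Local Notation I2 := (@I_ R 1).
Local Notation I3 := (@I_ R 2%:R).

Lemma tangent_space_Hopf_lift (Sigma : set CM4) z v :
  Hopf_lift Sigma z -> tangent_space (Hopf_lift Sigma) z v ->
  g z v = 0 /\ tangent_space Sigma (p1 z) (dp1 z v).
Proof.
move=> [Sz Pz] [c [e [e0 sm Mc c0 dc]]].
have d : differentiable (c : R^o -> C4) 0 by apply: (sm 1%N).1; exact: ballxx.
have oB : open (ball (0 : R^o) e) by exact: ball_open.
split.
  have n1 : \forall t \near (0 : R^o), S7 (c t).
    by apply: filterS (nbhsx_ballx (0 : R^o) e e0) => t /Mc [].
  have := diff_unit_perp (1 : R^o) n1 (differentiableP d).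
  by rewrite c0 -deriveE // dc.
exists (fun t => p1 (c t)), e; split=> //.
- by move=> n; exact: (@Cn_on_p1 R R^o n _ c oB (sm n)).
- by move=> t /Mc [].
- by rewrite c0.
- by rewrite (is_diff_derive (1 : R^o) (is_diff_p1 (differentiableP d))) c0 -deriveE // dc.
Qed.

Lemma rV2_span (e0 e1 : 'rV[R]_2) :
  (forall a b : R, a *: e0 + b *: e1 = 0 -> a = 0 /\ b = 0) ->
  forall k, exists a b, k = a *: e0 + b *: e1.
Proof.
move=> ind k; pose M : 'M[R]_2 := \matrix_(i < 2) (if i == 0 then e0 else e1).
have ME (c : 'rV[R]_2) : c *m M = c 0 0 *: e0 + c 0 1 *: e1.
  apply/rowP => j; rewrite !mxE !big_ord_recl big_ord0 addr0 !mxE /=.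
  by congr (c _ _ * _ + c _ _ * _); apply: val_inj.
have rf : row_free M.
  apply: inj_row_free => v; rewrite ME => /ind [v0 v1].
  apply/rowP => j; rewrite mxE; case: j => [[|[|//]] Hj].
    by rewrite -[RHS]v0; congr (v _ _); apply: val_inj.
  by rewrite -[RHS]v1; congr (v _ _); apply: val_inj.
exists ((k *m invmx M) 0 0), ((k *m invmx M) 0 1).
by rewrite -ME mulmxKV // -row_free_unit.
Qed.

(** Provides the independence of w and w' when w is nonzero. *)
Lemma I1'_orthogonal z a b h (w := a *: I2 z + b *: I3 z + h)
    (w' := b *: I2 z + (- a) *: I3 z + I1 h) : S7 z -> horizontal z h ->
  [/\ cperp z w, cperp z w', g w w' = 0 & g w' w' = g w w].
Proof.
move=> Sz hh; have hh' := horizontal_I1 hh.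
have [v0 v1] := cperp_vertical z a b; have [u0 u1] := cperp_vertical z b (- a).
have [h0 h1 h2 h3] := hh; have [k0 k1 k2 k3] := hh'.
have ghI : g h (I1 h) = 0 by rewrite gC g_I_self.
have e1 c d k : horizontal z k -> g k (c *: I2 z + d *: I3 z) = 0.
  by move=> hk; rewrite gC horizontal_vertical.
have e2 c d c' d' : g (c *: I2 z + d *: I3 z) (c' *: I2 z + d' *: I3 z) = c * c' + d * d'.
  by rewrite !gDl !gDr !gZl !gZr g_I2_I2 g_I3_I3 (gC (I3 z) (I2 z)) g_I2_I3 Sz; ring.
split.
- by split; rewrite gDr ?v0 ?v1 ?h0 ?h1 addr0.
- by split; rewrite gDr ?u0 ?u1 ?k0 ?k1 addr0.
- rewrite /w /w' gDl !(gDr _ _ (I1 h)) e2 (e1 _ _ _ hh) ghI horizontal_vertical //; ring.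
- rewrite /w /w' !(gDl _ _ h) !(gDl _ _ (I1 h)) !(gDr _ _ h) !(gDr _ _ (I1 h)) !e2 (e1 _ _ _ hh)
  (e1 _ _ _ hh') g_I1I1.
  rewrite !horizontal_vertical //; ring.
Qed.

(** A reference frame: the spanning clause expresses tangent bases and coordinate frames through f
    by a matrix, whose determinant is then the value of the form on them. *)
Lemma Hopf_lift_frame (Sigma : set CM4) z :
  I1'_holomorphic_curve Sigma -> Hopf_lift Sigma z ->
  exists f : 'I_3 -> C4,
  [/\ forall i j, squashed_metric z (f i) (f j) = (i == j)%:R, squashed_form z f = 1 &
      forall v, tangent_space (Hopf_lift Sigma) z v ->
        exists c : 'I_3 -> R, v = \sum_i c i *: f i].
Proof.
move=> [sC mS hol] Az; have [Sz Pz] := Az.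
have [U [psi [lp [x Ux Ex]]]] := mS _ Pz.
have [oU sm _ injd _] := lp.
(* Any nonzero vector of the chart domain would do: its image under the injective ['d psi x] is a
   nonzero tangent vector, from which holomorphy produces a second one. *)
pose e0 : 'rV[R]_2 := delta_mx 0 0.
have T0 : tangent_space Sigma (p1 z) ('d psi x e0) by rewrite -Ex;
  exact: (tangent_space_diff e0 lp Ux).
have /(tangent_space_CP3 _ Sz) [w cw Xw] := tangent_space_sub sC T0.
have [a [b [h [hh wE]]]] := cperp_decomposition Sz cw.
have [cw0 cw1 ww' w'w'] := I1'_orthogonal a b Sz hh.
rewrite -wE in cw0 ww' w'w'.
set w' := _ + I1 h in cw1 ww' w'w'.
have w'E : w' = b *: I2 z + (- a) *: I3 z + I1 h by [].
clearbody w'.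
have T1 : tangent_space Sigma (p1 z) (dp1 z w').
  by have := hol _ _ Pz T0; rewrite Xw wE I1'_CP3_dp1 // w'E.
have sub X : tangent_space Sigma (p1 z) X -> exists k, X = 'd psi x k.
  by rewrite -Ex; exact: (tangent_space_sub_diff has_coordinates_CM4 lp Ux).
have [e1 X1] := sub _ T1.
have w0 : w != 0.
  apply/eqP => w0; have /rowP/(_ 0) : e0 = 0.
    by apply: (injd x Ux); rewrite linear0 Xw w0 dp1r0.
  by rewrite !mxE !eqxx /= => /eqP; rewrite oner_eq0.
have gw0 : g w w != 0 by apply: contra w0 => /eqP/g_eq0/eqP.
(* The dimension of Sigma enters here: independence of w and w' makes e0 and e1 a basis of R^2, so
   the two tangent vectors fill the image of ['d psi x]. *)
have span k : exists al be, 'd psi x k = dp1 z (al *: w + be *: w').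
  have [al [be ->]] : exists al be, k = al *: e0 + be *: e1.
    apply: rV2_span => al be E.
    have : dp1 z (al *: w + be *: w') = dp1 z 0.
      rewrite dp1Dr !dp1Zr -Xw X1 -!linearZ -linearD E linear0.
      by rewrite dp1r0.
    have c0 : cperp z 0 by split; rewrite g0r.
    have cs : cperp z (al *: w + be *: w').
      by case: cw0 => p q; case: cw1 => p' q'; split; rewrite gDr !gZr ?p ?q ?p' ?q' !mulr0 addr0.
    move=> /(dp1_inj Sz cs c0) W.
    have : g w (al *: w + be *: w') = 0 by rewrite W g0r.
    rewrite gDr !gZr ww' mulr0 addr0 => /eqP; rewrite mulf_eq0 (negPf gw0) orbF => /eqP ->.
    split=> //.
    have : g w' (al *: w + be *: w') = 0 by rewrite W g0r.
    rewrite gDr !gZr (gC w') ww' mulr0 add0r w'w' => /eqP.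
    by rewrite mulf_eq0 (negPf gw0) orbF => /eqP.
  by exists al, be; rewrite linearD !linearZ /= Xw -X1 (dp1Dr z (al *: w)) (dp1Zr al) (dp1Zr be).
rewrite wE in w0.
have [s [s0 fon fv]] := adapted_frame Sz hh w0; rewrite -wE -w'E in fon fv.
exists (frame3 ((5 / 3) *: I1 z) (s *: w) (s *: w')); split=> // v Tv.
have [zv /sub [k]] := tangent_space_Hopf_lift Az Tv.
have [al [be ->]] := span k => E.
(* v and its [cperp] component have the same image under [dp1 z] and differ by a multiple of
   [I1 z]. *)
pose c := g (I1 z) v.
have vE : v = c *: I1 z + (al *: w + be *: w').
  rewrite -[LHS](subrK (c *: I1 z)) addrC; congr (_ + _).
  apply: (dp1_inj Sz).
  - split; rewrite gDr gNr gZr; first by rewrite zv gC g_I_self mulr0 subrr.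
    by rewrite g_I1I1 Sz mulr1 subrr.
  - by case: cw0 => p q; case: cw1 => p' q'; split; rewrite gDr !gZr ?p ?q ?p' ?q' !mulr0 addr0.
  - by rewrite -E dp1Dr dp1Nr dp1Zr dp1_I1_self scaler0 subr0.
exists (frame3 (c * (3 / 5)) (al / s) (be / s)).
rewrite sum_ord3 /frame3 /= !scalerA !mulfVK // -mulrA.
rewrite (_ : 3 / 5 * (5 / 3) = 1 :> R) ?mulr1; last by field.
by rewrite {1}vE addrA.
Qed.

Lemma vproj_linear (z : C4) : linear (vproj z).
Proof.
move=> a u v; rewrite /vproj scaler_sumr -big_split; apply: eq_bigr => i _.
by rewrite /= eta_linear scalerDl scalerA.
Qed.

Lemma squashed_metric_linearr (z u : C4) : linear (squashed_metric z u : C4 -> R^o).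
Proof.
move=> a v w; rewrite /squashed_metric vproj_linear hproj_linear.
by move: (_ ^+ 2) (_ ^+ 2) => k k'; rewrite (gDr _ (a *: vproj z v)) (gDr _ (a *:
  hproj z v)) !(gZr a) -[a *: _]/(a * _); ring.
Qed.

Lemma squashed_metricC (z u v : C4) : squashed_metric z u v = squashed_metric z v u.
Proof. by congr (_ * _ + _ * _); rewrite gC. Qed.

Lemma frame_coefficients (e f : 'I_3 -> C4) :
  (forall i, exists c : 'I_3 -> R, e i = \sum_j c j *: f j) ->
  exists A : 'M[R]_3, forall i, e i = \sum_j A i j *: f j.
Proof.
move=> /choice [c H]; exists (\matrix_(i, j) c i j) => i.
by rewrite H; apply: eq_bigr => j _; rewrite mxE.
Qed.

(** The Gram matrix of e is A A^T, so A is orthogonal. *)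
Lemma orthonormal_det (z : C4) (e f : 'I_3 -> C4) (A : 'M[R]_3) :
  (forall i j, squashed_metric z (f i) (f j) = (i == j)%:R) ->
  (forall i j, squashed_metric z (e i) (e j) = (i == j)%:R) ->
  (forall i, e i = \sum_j A i j *: f j) -> \det A ^+ 2 = 1.
Proof.
move=> fon eon eE.
have : A *m A^T = 1%:M.
  apply/matrixP => i j; rewrite mxE [RHS]mxE -eon [in RHS](eE j).
  rewrite (linear_sumE _ _ (@squashed_metric_linearr z (e i))); apply: eq_bigr => k _.
  rewrite mxE squashed_metricC (eE i) (linear_sumE _ _ (@squashed_metric_linearr z (f k))).
  rewrite (bigD1 k) //= big1 => [|l lk]; first
    by rewrite addr0 fon eqxx /GRing.scale /= mulr1 mulrC.
  by rewrite fon eq_sym (negPf lk) scaler0.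
by move=> /(congr1 determinant); rewrite det_mulmx det_tr det1 expr2.
Qed.

(** A row vector killed by A is killed by ['d Phi y]. Consequently the form does not vanish on a
    coordinate frame of the lift. *)
Lemma coordinate_frame_det (V : normedModType R) (Phi : 'rV[R]_3 -> V) y (f : 'I_3 ->
  V) (A : 'M[R]_3) :
  injective ('d Phi y) -> (forall i, coordinate_frame Phi y i = \sum_j A i j *: f j) ->
  \det A != 0.
Proof.
move=> inj fE; rewrite -unitfE -unitmxE -row_free_unit; apply: inj_row_free => c cA.
apply: inj; rewrite linear0 [c]row_sum_delta linear_sum.
under eq_bigr do rewrite linearZ /= -/(coordinate_frame Phi y _) fE scaler_sumr.
rewrite exchange_big /=; apply: big1 => j _.
under eq_bigr do rewrite scalerA.
rewrite -scaler_suml (_ : \sum_i _ = (c *m A) 0 j); first by rewrite cA mxE scale0r.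
by rewrite mxE.
Qed.

(* Written without subtraction, in the shape of the closure lemmas for [Cn_on]. *)
Lemma squashed_formE (z : C4) (e : 'I_3 -> C4) : squashed_form z e = 27 / 25 * (1 / 5 *
  (eta 0 z (e 0) * (eta 1 z (e 1) * eta 2%:R z (e 2%:R) +
    - 1 * (eta 1 z (e 2%:R) * eta 2%:R z (e 1)))
   + - 1 * (eta 0 z (e 1) * (eta 1 z (e 0) * eta 2%:R z (e 2%:R) +
     - 1 * (eta 1 z (e 2%:R) * eta 2%:R z (e 0))))
   + eta 0 z (e 2%:R) * (eta 1 z (e 0) * eta 2%:R z (e 1) +
     - 1 * (eta 1 z (e 1) * eta 2%:R z (e 0))))
  + \sum_i (eta i z (e 0) * omega i z (e 1) (e 2%:R) +
    - 1 * (eta i z (e 1) * omega i z (e 0) (e 2%:R))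
            + eta i z (e 2%:R) * omega i z (e 0) (e 1))).
Proof.
rewrite /squashed_form det3 !mxE !mulN1r; congr (_ * (_ + _)).
by apply: eq_bigr => i _; rewrite mulN1r.
Qed.

(** Lets positivity of the form on a coordinate frame spread from one point to a neighbourhood. *)
Lemma squashed_form_continuous (V : normedModType R) (U : set V) (z : V -> C4) (e : 'I_3 -> V ->
  C4) :
  open U -> Cn_on 0 U z -> (forall i, Cn_on 0 U (e i)) ->
  Cn_on 0 U (fun y => squashed_form (z y) (fun i => e i y)).
Proof.
move=> oU cz ce.
have clin (L : C4 -> C4) f : linear L -> Cn_on 0 U f -> Cn_on 0 U (fun y => L (f y)).
  by move=> lL cf; apply: Cn_on_linear => //;
    exact: (linear_finite_continuous has_coordinates_C4 lL).
have nlin : linear (-%R : C4 -> C4) by move=> a u v; rewrite opprD scalerN.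
have cxi i : Cn_on 0 U (fun y => xi i (z y)).
  exact: (clin -%R _ nlin (clin (I_ i) z (I_linear i) cz)).
have ceta i f : Cn_on 0 U f -> Cn_on 0 U (fun y => eta i (z y) (f y)).
  by move=> cf; exact: (Cn_on_g oU (cxi i) cf).
have chp f : Cn_on 0 U f -> Cn_on 0 U (fun y => hproj (z y) (f y)).
  move=> cf; have ct i := Cn_on_scale oU (ceta i f cf) (cxi i).
  have cv : Cn_on 0 U (fun y => vproj (z y) (f y)).
    apply: (Cn_on_ext oU _ (Cn_on_add oU (Cn_on_add oU (ct 0) (ct 1)) (ct 2%:R))) => y _.
    exact: esym (vprojE _ _).
  exact: (Cn_on_add oU cf (clin -%R _ nlin cv)).
have com i f f' : Cn_on 0 U f -> Cn_on 0 U f' -> Cn_on 0 U (fun y => omega i (z y) (f y) (f' y)).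
  move=> cf cf'.
  have ci := clin (I_ i) _ (I_linear i) (chp f cf).
  have := Cn_on_mul oU (Cn_on_cst 0 U (- 1 : R)) (Cn_on_g oU ci (chp f' cf')).
  by apply: (Cn_on_ext oU) => y _; rewrite omegaE mulN1r.
have csum (F : 'I_3 -> V -> R) : (forall i, Cn_on 0 U (F i)) -> Cn_on 0 U (fun y => \sum_i F i y).
  by move=> H x Ux; apply: (@continuous_sum_ord R V R^o) => i; exact: H.
have cadd (f f' : V -> R) : Cn_on 0 U f -> Cn_on 0 U f' -> Cn_on 0 U (fun y => f y + f' y).
  exact: (@Cn_on_add R V R^o).
have cmul (f f' : V -> R) : Cn_on 0 U f -> Cn_on 0 U f' -> Cn_on 0 U (fun y => f y * f' y).
  exact: Cn_on_mul.
have ccst (a : R) : Cn_on 0 U (fun _ : V => a) by exact: Cn_on_cst.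
have ce' i j : Cn_on 0 U (fun y => eta i (z y) (e j y)) by exact: (ceta i (e j) (ce j)).
have cf i j k : Cn_on 0 U (fun y => omega i (z y) (e j y) (e k y))
  by exact: (com i _ _ (ce j) (ce k)).
under [X in Cn_on _ _ X]eq_fun do rewrite squashed_formE.
apply: (cmul) => //; apply: (cadd); last first.
  apply: csum => i; apply: (cadd); last exact: cmul.
  by apply: (cadd); [exact: cmul | apply: (cmul) => //; exact: cmul].
have c2 i j k l i' j' k' l' : Cn_on 0 U (fun y => eta i (z y) (e j y) * eta k (z y) (e l y)
    + - 1 * (eta i' (z y) (e j' y) * eta k' (z y) (e l' y))).
  by apply: (cadd); [exact: cmul | apply: (cmul) => //; exact: cmul].
apply: (cmul) => //; apply: (cadd); last exact: cmul.
by apply: (cadd); [exact: cmul | apply: (cmul) => //; exact: cmul].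
Qed.

(** z is its own reference vector, and [g (I1 z) z = 0] puts it at fibre coordinate 0 for every s.
    The charts for s = 1 and s = -1 can thus be compared at the same point. *)
Lemma Hopf_lift_chart_at (Sigma : set CM4) z : I1'_holomorphic_curve Sigma -> Hopf_lift Sigma z ->
  exists U0 psi x, [/\ local_parametrization Sigma U0 psi,
    hopf_domain z U0 psi (join_coord x 0) &
    forall s : R, s != 0 -> hopf_chart z s psi (join_coord x 0) = z].
Proof.
move=> [sC mS hol] [Sz Pz]; have [U0 [psi [lp [x Ux Ex]]]] := mS _ Pz.
exists U0, psi, x.
have g0 : 0 < g z z by rewrite Sz ltr01.
have H (s : R) : s != 0 -> hopf_domain z U0 psi (join_coord x 0) /\ hopf_chart z s psi
  (join_coord x 0) = z.
  move=> s0; have := hopf_chart_surj sC s0 lp Sz (esym Ex) Ux g0.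
  by rewrite g_I_self mul0r mulr0.
split=> //; first by case: (H 1 (oner_neq0 _)).
by move=> s /H [].
Qed.

(** Changing the sign of s amounts to precomposing the chart with this orientation-reversing map. *)
Definition reflect_fiber (y : 'rV[R]_3) : 'rV[R]_3 := join_coord (base_coord y) (- fiber_coord y).

Lemma reflect_fiberE y i : reflect_fiber y 0 i = if i == 2%:R then - y 0 i else y 0 i.
Proof.
have /eqP := coordK y; rewrite /reflect_fiber => /eqP yE.
case: eqP => [->|ni].
  by rewrite -[LHS]/(fiber_coord _) fiber_coord_join.
rewrite -[in RHS]yE /join_coord !mxE; case: fintype.splitP => l li //.
by case: ni; apply: val_inj; rewrite /= li ord1.
Qed.

Lemma hopf_chart_opp z (s : R) psi y : hopf_chart z (- s) psi y =
  hopf_chart z s psi (reflect_fiber y).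
Proof. by rewrite /hopf_chart base_coord_join fiber_coord_join mulrN mulNr. Qed.

Lemma coordinate_frame_reflect (Sigma : set CM4) z U0 psi x : Sigma `<=` @CP3 R ->
  local_parametrization Sigma U0 psi -> hopf_domain z U0 psi (join_coord x 0) ->
  forall i, coordinate_frame (hopf_chart z (- 1) psi) (join_coord x 0) i =
   \sum_j (diag_mx (\row_k (if k == 2%:R :> 'I_3 then - 1 else 1 : R))) i j *:
      coordinate_frame (hopf_chart z 1 psi) (join_coord x 0) j.
Proof.
move=> sC lp Dy i.
rewrite (bigD1 i) //= big1 ?addr0 => [|j ji];
  last by rewrite !mxE [i == j]eq_sym (negPf ji) mulr0n scale0r.
rewrite !mxE eqxx mulr1n.
have lr : linear reflect_fiber.
  move=> a u v; apply/rowP => j; rewrite [RHS]mxE [X in _ = X + _]mxE !reflect_fiberE !mxE.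
  by case: eqP => _ //; ring.
have cr := linear_finite_continuous (has_coordinates_mx _ _) lr.
set y := join_coord x 0.
have ry : reflect_fiber y = y by rewrite /reflect_fiber base_coord_join fiber_coord_join oppr0.
have d : differentiable (hopf_chart z 1 psi) (reflect_fiber y).
  have [_ sm _ _ _] := hopf_chart_parametrization z sC (oner_neq0 R) lp.
  by rewrite ry; exact: (sm 1%N).1.
have -> : hopf_chart z (- 1) psi = hopf_chart z 1 psi \o reflect_fiber.
  by apply/funext => u; rewrite hopf_chart_opp.
have DC := is_diff_comp (is_diff_linear y lr cr) (differentiableP d).
have [dC _] := DC.
have L := etrans (esym (deriveE (delta_mx 0 i) dC)) (is_diff_derive (delta_mx 0 i) DC).
apply: (etrans L).
set c := (if _ then _ else _).
have E : reflect_fiber (delta_mx 0 i) = c *: delta_mx 0 i.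
  apply/rowP => j; rewrite reflect_fiberE !mxE eqxx /= /c.
  case: (eqVneq j i) => [->|ji]; last by rewrite mulr0; case: ifP; rewrite ?oppr0.
  by case: ifP => _; rewrite mulr1.
rewrite -[LHS]/('d (hopf_chart z 1 psi) (reflect_fiber y) (reflect_fiber (delta_mx 0 i))).
by rewrite ry E; exact: linearZ.
Qed.

Lemma det_reflection : \det (diag_mx (\row_k (if k == 2%:R :> 'I_3 then - 1 else 1 : R))) = - 1.
Proof. by rewrite det3 !mxE /=; ring. Qed.

(** On the coordinate frame at p the form takes the value det A, where A expresses this frame
    through the one of [Hopf_lift_frame]. It is nonzero, and if it is negative the chart with s = -1
    replaces that with s = 1; the domain is then cut down to the open set where the form is
    positive. *)
Lemma Hopf_lift_oriented_chart (Sigma : set CM4) p :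
  I1'_holomorphic_curve Sigma -> Hopf_lift Sigma p ->
  exists (U : set 'rV[R]_3) Phi, [/\ local_parametrization (Hopf_lift Sigma) U Phi, (Phi @` U) p &
    forall x, U x -> 0 < squashed_form (Phi x) (coordinate_frame Phi x)].
Proof.
move=> hol Ap; have [sC _ _] := hol.
have [U0 [psi [x [lp Dx px]]]] := Hopf_lift_chart_at hol Ap.
pose y := join_coord x 0.
have H (s : R) : s != 0 -> 0 < squashed_form p (coordinate_frame (hopf_chart p s psi) y) ->
   exists (U : set 'rV[R]_3) Phi, [/\ local_parametrization (Hopf_lift Sigma) U Phi, (Phi @` U)
     p &
    forall x, U x -> 0 < squashed_form (Phi x) (coordinate_frame Phi x)].
  move=> s0 sp; have lpA := hopf_chart_parametrization p sC s0 lp.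
  have [oD sm _ _ _] := lpA.
  pose F u := squashed_form (hopf_chart p s psi u) (coordinate_frame (hopf_chart p s psi) u).
  have cF : Cn_on 0 (hopf_domain p U0 psi) (F : _ -> R^o).
    have := squashed_form_continuous oD (sm 0%N) (fun i => (sm 1%N).2 (delta_mx 0 i)).
    apply: (Cn_on_ext oD) => u Du; apply: (congr1 (squashed_form (hopf_chart p s psi u))).
    by apply/funext => i; apply: deriveE; exact: (sm 1%N).1.
  exists [set u | hopf_domain p U0 psi u /\ 0 < F u], (hopf_chart p s psi); split.
  - apply: local_parametrization_restrict lpA _ _; first exact: open_positive.
    by move=> u [].
  - have E : hopf_chart p s psi y = p := px s s0.
    exists y; last exact: E.
    by split; [exact: Dx | rewrite /F E; exact: sp].
  - by move=> u [].
have lpA := hopf_chart_parametrization p sC (oner_neq0 R) lp.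
have [f [_ ff fs]] := Hopf_lift_frame hol Ap.
have [_ _ _ injd _] := lpA.
have [A fA] : exists A : 'M[R]_3, forall i,
    coordinate_frame (hopf_chart p 1 psi) y i = \sum_j A i j *: f j.
  apply: frame_coefficients => i; apply: fs.
  by have := tangent_space_diff (delta_mx 0 i) lpA Dx; rewrite (px 1 (oner_neq0 R)).
have A0 := coordinate_frame_det (injd y Dx) fA.
have E1 := etrans (squashed_form_mul p fA) (etrans (congr1 ( *%R (\det A)) ff) (mulr1 _)).
have E2 := etrans (squashed_form_mul p (coordinate_frame_reflect sC lp Dx))
  (f_equal2 *%R det_reflection E1).
have [Ap0|An0] := ltP 0 (\det A).
  by apply: (H 1 (oner_neq0 R)); exact: (eq_ind_r (fun t => 0 < t) Ap0 E1).
have N1 : - 1 != 0 :> R by rewrite oppr_eq0 oner_neq0.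
have d0 : 0 < - 1 * \det A by rewrite mulN1r oppr_gt0 lt_neqAle A0.
apply: (H (- 1) N1); exact: (eq_ind_r (fun t => 0 < t) d0 E2).
Qed.

Lemma Hopf_lift_associative (Sigma : set CM4) :
  I1'_holomorphic_curve Sigma -> associative_submanifold (Hopf_lift Sigma).
Proof.
move=> hol; split; first by move=> z [].
  move=> p /(Hopf_lift_oriented_chart hol) [U [Phi [lp pU _]]].
  by exists U, Phi.
(* Compatibility with positive determinants is [squashed_form_mul], and local constancy is given by
   the oriented charts. *)
exists (fun p e => 0 < squashed_form p e); split; [split|].
- move=> p Ap e e' [Te _ se] [Te' _ _] oe.
  split=> [oe'|[A [A0 eA]]]; last first.
    exact: (eq_ind_r (fun t => 0 < t) (mulr_gt0 A0 oe) (squashed_form_mul p eA)).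
  have [A eA] : exists A : 'M[R]_3, forall i, e' i = \sum_j A i j *: e j.
    by apply: frame_coefficients => i; apply: se.
  exists A; split=> //; move: oe'; rewrite (squashed_form_mul p eA).
  by rewrite pmulr_lgt0.
- by move=> p; exact: Hopf_lift_oriented_chart.
- move=> p Ap e [Te _ _] eon oe.
  have [f [fon ff fs]] := Hopf_lift_frame hol Ap.
  have [A eA] : exists A : 'M[R]_3, forall i, e i = \sum_j A i j *: f j.
    by apply: frame_coefficients => i; apply: fs.
  (* The form takes the value det A on e; orthonormality leaves 1 or -1, and positivity selects
     1. *)
  have /eqP := orthonormal_det fon eon eA.
  move: oe; rewrite (squashed_form_mul p eA) ff mulr1 sqrf_eq1 => A0 /orP[/eqP //|/eqP AN].
  by move: A0; rewrite AN oppr_gt0 ltr10.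
Qed.

End HopfLift.

Theorem proposition4p9 (R : realType) (Sigma : set (CM4 R)) :
  I1'_holomorphic_curve Sigma -> associative_submanifold (Hopf_lift Sigma).
Proof. exact: Hopf_lift_associative. Qed.
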